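(* Let $p\ge1$, $\varepsilon>0$, $\eta>0$, $\alpha\le1/10^{p+1}$ and $\delta\le\min(\alpha^7/600,\alpha/n)$. Let $\mu_1,\dots,\mu_k$ be discrete distributions on $\mathbb{R}^d$, $X=\bigcup_i\mathrm{supp}(\mu_i)$, and let $\pi:\mathbb{R}^d\to\mathbb{R}^m$ be a random $(\varepsilon,\delta,\alpha)$-standard dimensionality reduction map. Let $\nu^*=\sum_{j=1}^nb_j\delta_{c_j^*}$ be an optimal Wasserstein barycenter (support size at most $n$) and let $\mathcal{C}^*=(C_1^*,\dots,C_n^* )$ with weights $w_j^*$ be the solution given by the optimal couplings of the $\mu_i$ to $\nu^*$. Let $\mathcal{C}=(C_1,\dots,C_n)$ with weights $w_j$ be any solution (possibly random, depending on $\pi$), and let $C=C_j$ be any fixed cluster of $\mathcal{C}$. Then with probability at least $1-\eta-\binom n2\delta$, \[\mathrm{cost}_p(\pi(C))\le A\big(\mathrm{cost}_p(C)+c_{\eta\varepsilon\alpha}\mathrm{cost}_p(\mathcal{C}^* )\big),\qquad \mathrm{cost}_p(C)\le A\big(\mathrm{cost}_p(\pi(C))+c_{\eta\varepsilon\alpha}\mathrm{cost}_p(\mathcal{C}^* )\big),\] where $A=(1+\varepsilon)^{3p-2}(1+3^{p+2}\alpha^{1/(p+1)})$ and $c_{\eta\varepsilon\alpha}=\frac{5(1+\varepsilon)^p\alpha}{\eta\varepsilon^{p-1}}$.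
   Context: $W_p$ is the Wasserstein distance with Euclidean ground metric; an optimal barycenter minimizes $\frac1k\sum_iW_p(\mu_i,\nu)^p$ among $\nu$ with at most $n$ support points. A solution $(C_1,\dots,C_n,w_1,\dots,w_n)$ comes from the optimal couplings of each $\mu_i$ to some fixed $\nu$ with support points $\nu^1,\dots,\nu^n$: $w_j(x)\ge0$ is the mass sent from point $x$ to $\nu^j$, $C_j=\{x\in X:w_j(x)>0\}$. For a cluster, $\mathrm{cost}_p(C_j)=\min_{c\in\mathbb{R}^d}\sum_{x\in C_j}w_j(x)\|x-c\|^p$ and $\mathrm{cost}_p(\pi(C_j))=\min_{c\in\mathbb{R}^m}\sum_{x\in C_j}w_j(x)\|\pi(x)-c\|^p$; $\mathrm{cost}_p(\mathcal{C}^* )=\sum_{j=1}^n\sum_{x\in X}w_j^*(x)\|x-c_j^*\|^p$. A random map $\pi:\mathbb{R}^d\to\mathbb{R}^m$ is an $(\varepsilon,\delta,\alpha)$-dimension reduction if for every $x,y\in\mathbb{R}^d$, with probability at least $1-\delta$, $\frac1{1+\varepsilon}\|x-y\|\le\|\pi(x)-\pi(y)\|\le(1+\varepsilon)\|x-y\|$, and $\mathbb{E}\big[\mathbf{1}\{\|\pi(x)-\pi(y)\|>(1+\varepsilon)\|x-y\|\}\big(\frac{\|\pi(x)-\pi(y)\|^p}{\|x-y\|^p}-(1+\varepsilon)^p\big)\big]\le\alpha$; it is standard if the parameters allow $\delta\le\exp(-c\varepsilon^2m)$ and $\alpha\le\exp(-c\varepsilon^2m)$ whenever $m\ge c'p/\varepsilon^2$,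 for absolute constants $c,c'>0$ (e.g. scaled Gaussian matrices). *)

(* Defs.v *)
From HB Require Import structures.
From mathcomp Require Export all_boot all_order all_algebra finmap.
From mathcomp Require Export all_classical all_reals all_analysis.

Set Implicit Arguments.
Unset Strict Implicit.
Unset Printing Implicit Defensive.

Import Order.TTheory GRing.Theory Num.Theory.

Local Open Scope classical_set_scope.
Local Open Scope fset_scope.
Local Open Scope ring_scope.

(* The library norm `|x| on row vectors is the sup norm, hence this one. *)
Definition enorm (R : realType) (d : nat) (x : 'rV[R]_d) : R :=
  Num.sqrt (\sum_(i < d) x ord0 i ^+ 2).

Section Transport.
Variables (R : realType) (d : nat) (p : R).
Local Notation E := 'rV[R]_d.

(* A finitely supported function is identified with the combination of Dirac
   masses it gives weights to; finsupp is then the support. *)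
Definition is_distribution (mu : {fsfun E -> R with 0}) : Prop :=
  (forall x, 0 <= mu x) /\ \sum_(x <- finsupp mu) mu x = 1.

Definition coupling (mu nu : {fsfun E -> R with 0})
    (g : {fsfun E * E -> R with 0}) : Prop :=
  [/\ forall z, 0 <= g z,
      forall x, \sum_(z <- finsupp g | z.1 == x) g z = mu x
    & forall y, \sum_(z <- finsupp g | z.2 == y) g z = nu y].

Definition transport_cost (g : {fsfun E * E -> R with 0}) : R :=
  \sum_(z <- finsupp g) g z * enorm (z.1 - z.2) `^ p.

Definition wasserstein (mu nu : {fsfun E -> R with 0}) : R :=
  inf [set transport_cost g | g in coupling mu nu] `^ p^-1.

Definition optimal_coupling (mu nu : {fsfun E -> R with 0})
    (g : {fsfun E * E -> R with 0}) : Prop :=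
  coupling mu nu g /\
  forall g', coupling mu nu g' -> transport_cost g <= transport_cost g'.

Section Barycenter.
Variables (k n : nat) (mu : 'I_k -> {fsfun E -> R with 0}).

Definition barycenter_cost (nu : {fsfun E -> R with 0}) : R :=
  k%:R^-1 * \sum_(i < k) wasserstein (mu i) nu `^ p.

Definition optimal_barycenter (nu : {fsfun E -> R with 0}) : Prop :=
  [/\ is_distribution nu, (#|` finsupp nu| <= n)%N
    & forall nu', is_distribution nu' -> (#|` finsupp nu'| <= n)%N ->
        barycenter_cost nu <= barycenter_cost nu'].

Definition all_points : {fset E} := \big[fsetU/fset0]_(i < k) finsupp (mu i).

(* nu = \sum_j b_j delta_(c_j) with distinct c_j and b_j = nu (c_j); b_j = 0 is
   allowed, so that nu may have fewer than n support points. *)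
Definition support_points (nu : {fsfun E -> R with 0}) (c : 'I_n -> E) : Prop :=
  injective c /\ forall y, y \in finsupp nu -> exists j, c j = y.

(* w j x is the total mass, over the k couplings, sent from x to c j. *)
Definition solution_to (nu : {fsfun E -> R with 0}) (c : 'I_n -> E)
    (w : 'I_n -> E -> R) : Prop :=
  [/\ is_distribution nu, support_points nu c
    & exists g : 'I_k -> {fsfun E * E -> R with 0},
        (forall i, optimal_coupling (mu i) nu (g i)) /\
        (forall j x, w j x = \sum_(i < k) g i (x, c j))].

Definition solution (w : 'I_n -> E -> R) : Prop :=
  exists nu c, solution_to nu c w.

Definition cluster (wj : E -> R) : {fset E} :=
  [fset x in all_points | 0 < wj x].

(* With f the identity this is the cost of the cluster, and with f := pi the
   cost of its image. The infimum is attained. *)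
Definition cluster_cost (m : nat) (f : E -> 'rV[R]_m) (wj : E -> R) : R :=
  inf (range (fun c : 'rV[R]_m =>
    \sum_(x <- cluster wj) wj x * enorm (f x - c) `^ p)).

Definition solution_cost (c : 'I_n -> E) (w : 'I_n -> E -> R) : R :=
  \sum_(j < n) \sum_(x <- all_points) w j x * enorm (x - c j) `^ p.

End Barycenter.
End Transport.

Section RandomMaps.
Variables (R : realType) (dT : measure_display) (T : measurableType dT).
Variables (P : probability T R) (d m : nat).
Local Notation E := 'rV[R]_d.

(* For every x, pi(x) is a random vector. *)
Definition random_map (pi : T -> E -> 'rV[R]_m) : Prop :=
  forall x i, measurable_fun setT (fun t => pi t x ord0 i).

(* When x = y the indicator is 0, which hides the quotient 0 / 0. *)
Definition dimension_reduction (p eps delta alpha : R)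
    (pi : T -> E -> 'rV[R]_m) : Prop :=
  random_map pi /\
  forall x y : E,
    ((1 - delta)%:E <=
       P [set t | ((1 + eps)^-1 * enorm (x - y) <= enorm (pi t x - pi t y)
                    <= (1 + eps) * enorm (x - y))%R])%E /\
    ('E_P[fun t =>
       (\1_[set s | (1 + eps) * enorm (x - y) < enorm (pi s x - pi s y)] t *
        (enorm (pi t x - pi t y) `^ p / enorm (x - y) `^ p
           - (1 + eps) `^ p))%R]
     <= alpha%:E)%E.

(* c and c' are the absolute constants. Besides delta and alpha, the map admits
   parameters delta' and alpha' that are exponentially small in eps^2 m as soon
   as m is at least c' p / eps^2. *)
Definition standard_dimension_reduction (c c' p eps delta alpha : R)
    (pi : T -> E -> 'rV[R]_m) : Prop :=
  dimension_reduction p eps delta alpha pi /\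
  (c' * p / eps ^+ 2 <= m%:R ->
   exists delta' alpha',
     [/\ delta' <= expR (- (c * eps ^+ 2 * m%:R)),
         alpha' <= expR (- (c * eps ^+ 2 * m%:R))
       & dimension_reduction p eps delta' alpha' pi]).

(* The weights are random variables. The barycenter and the couplings that
   give the solution may vary with t. *)
Definition random_solution (p : R) (k n : nat)
    (mu : 'I_k -> {fsfun E -> R with 0}) (w : T -> 'I_n -> E -> R) : Prop :=
  (forall j x, measurable_fun setT (fun t => w t j x)) /\
  forall t, solution p mu (w t).

End RandomMaps.

(* Main.v *)
(* Let c_x be the center of the optimal solution nearest to x, M(x) the total
   mass of x, and v the sum of the M(x) |x - c_x|^p, which is at most
   the optimal cost.  Call x bad if it is distorted with respect to a center,
   or with respect to points y carrying a fraction of more than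
   (alpha^5/150)(alpha/2) of v.  By Markov's inequality and the union bound,
   outside an event of probability eta + binom(n,2) delta no pair of centers is
   distorted and the bad points, together with the excess stretching of the
   pairs (x, c_x), contribute at most 5 alpha v / eta.  This event does not
   involve the weights of the solution, so they may depend on the map.

   Given the weights, move to c_x every x of the cluster that is bad or very
   close to c_x.  This changes the costs by a controlled amount, and among the
   moved points each one is distorted with respect to an alpha^5/150 fraction of
   the mass only.  It remains to compare the costs of two configurations a and b
   with |b_i - b_j| <= L |a_i - a_j| except for such few pairs.  For p = 2 the
   averaging argument of Kirszbraun's theorem does this: the cost around the
   barycenter is a sum over pairs.  For general p, weights that depend on the
   distances reduce to an even exponent, whose minimizer is a barycenter for
   suitable weights; Young's inequality then removes the weights.  Points far
   from the center are handled by the triangle inequality through a typical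
   point. *)
Require Import Defs.
From mathcomp Require Import measurable_realfun ring lra.

Import Order.TTheory GRing.Theory Num.Theory.
Import numFieldNormedType.Exports.
Local Open Scope classical_set_scope.
Local Open Scope ring_scope.

(** * Euclidean norm and power inequalities *)

Section EuclideanNorm.
Context {R : realType} {d : nat}.
Implicit Types x y z : 'rV[R]_d.

Definition dot x y : R := \sum_(i < d) x ord0 i * y ord0 i.

Definition sqnorm x : R := \sum_(i < d) x ord0 i ^+ 2.

Lemma sqnorm_ge0 x : 0 <= sqnorm x.
Proof. by apply: sumr_ge0 => i _; exact: sqr_ge0. Qed.

Lemma enorm_ge0 x : 0 <= enorm x.
Proof. exact: sqrtr_ge0. Qed.

Lemma sqr_enorm x : enorm x ^+ 2 = sqnorm x.
Proof. by rewrite sqr_sqrtr// sqnorm_ge0. Qed.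

Lemma enorm0 : enorm (0 : 'rV[R]_d) = 0.
Proof. by rewrite /enorm big1 ?sqrtr0// => i _; rewrite mxE expr0n. Qed.

Lemma sqnormZ (k : R) x : sqnorm (k *: x) = k ^+ 2 * sqnorm x.
Proof. by rewrite /sqnorm mulr_sumr; apply: eq_bigr => i _; rewrite mxE exprMn. Qed.

Lemma enormZ (k : R) x : enorm (k *: x) = `|k| * enorm x.
Proof.
by rewrite /enorm -/(sqnorm _) sqnormZ sqrtrM ?sqr_ge0// sqrtr_sqr.
Qed.

Lemma enormN x : enorm (- x) = enorm x.
Proof. by rewrite -scaleN1r enormZ normrN normr1 mul1r. Qed.

Lemma enormB x y : enorm (x - y) = enorm (y - x).
Proof. by rewrite -opprB enormN. Qed.

Lemma sqnormD x y : sqnorm (x + y) = sqnorm x + 2 * dot x y + sqnorm y.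
Proof.
rewrite /sqnorm /dot mulr_sumr -!big_split/=.
by apply: eq_bigr => i _; rewrite mxE; ring.
Qed.

(** Cauchy-Schwarz: expand the nonnegative [sqnorm] of [sqnorm y *: x - dot x y *: y] and divide by
    [sqnorm y]. *)
Lemma dot_le x y : dot x y <= enorm x * enorm y.
Proof.
have [y0|y0] := eqVneq (sqnorm y) 0.
  suff -> : dot x y = 0 by rewrite mulr_ge0// enorm_ge0.
  rewrite /dot big1// => i _.
  have /eqP := y0; rewrite psumr_eq0 => [/allP/(_ i)|j _]; last exact: sqr_ge0.
  by rewrite mem_index_enum sqrf_eq0 => /(_ isT)/eqP->; rewrite mulr0.
have y_gt0 : 0 < sqnorm y by rewrite lt0r y0 sqnorm_ge0.
have := sqnorm_ge0 (sqnorm y *: x + (- dot x y) *: y).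
rewrite sqnormD !sqnormZ.
have -> : dot (sqnorm y *: x) (- dot x y *: y) = - (sqnorm y * dot x y ^+ 2).
  rewrite {1}/dot; under eq_bigr do rewrite !mxE mulrACA.
  by rewrite -mulr_sumr -/(dot x y); ring.
move=> h.
have {}h : dot x y ^+ 2 <= sqnorm x * sqnorm y.
  rewrite -(ler_pM2l y_gt0); nra.
rewrite real_leNgt ?num_real//; apply/negP => hlt.
have : (enorm x * enorm y) ^+ 2 < dot x y ^+ 2.
  by rewrite ltr_pXn2r// ?nnegrE ?mulr_ge0 ?enorm_ge0// (le_trans _ (ltW hlt))//
      mulr_ge0 ?enorm_ge0.
by rewrite exprMn !sqr_enorm ltNge h.
Qed.

Lemma enormD x y : enorm (x + y) <= enorm x + enorm y.
Proof.
rewrite -(@ler_pXn2r _ 2)// ?nnegrE ?addr_ge0 ?enorm_ge0//.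
rewrite sqr_enorm sqnormD sqrrD !sqr_enorm lerD2r lerD2l.
by rewrite -[leRHS]mulr_natl ler_pM2l// dot_le.
Qed.

Lemma enorm_dist z x y : enorm (x - y) <= enorm (x - z) + enorm (z - y).
Proof. by rewrite -[x - y](subrKA z) enormD. Qed.

Lemma enorm_sum (I : finType) (P : pred I) (f : I -> 'rV[R]_d) :
  enorm (\sum_(i | P i) f i) <= \sum_(i | P i) enorm (f i).
Proof.
elim/big_ind2 : _ => [|a x b y ha hb|//]; first by rewrite enorm0.
by rewrite (le_trans (enormD _ _))// lerD.
Qed.

(** The pairwise form of the variance; the last term vanishes when [c] is the weighted barycenter.
    Everything splits over coordinates, where it is the expansion of a square. *)
Lemma sum_sqnorm_pairs (I : finType) (P : pred I) (lam : I -> R)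
    (z : I -> 'rV[R]_d) (c : 'rV[R]_d) :
  \sum_(i | P i) \sum_(j | P j) lam i * lam j * sqnorm (z i - z j) =
  2 * ((\sum_(i | P i) lam i) * (\sum_(i | P i) lam i * sqnorm (z i - c))
       - sqnorm (\sum_(i | P i) lam i *: (z i - c))).
Proof.
pose y (i : I) (k : 'I_d) : R := (z i - c) ord0 k.
have E1 i : sqnorm (z i - c) = \sum_(k < d) y i k ^+ 2 by [].
have E2 i j : sqnorm (z i - z j) = \sum_(k < d) (y i k - y j k) ^+ 2.
  by apply: eq_bigr => k _; rewrite /y !mxE; congr (_ ^+ 2); ring.
have E3 : sqnorm (\sum_(i | P i) lam i *: (z i - c)) =
    \sum_(k < d) (\sum_(i | P i) lam i * y i k) ^+ 2.
  by apply: eq_bigr => k _; rewrite summxE; congr (_ ^+ 2); apply: eq_bigr => i _;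
      rewrite mxE.
have E4 : \sum_(i | P i) lam i * sqnorm (z i - c) =
    \sum_(k < d) \sum_(i | P i) lam i * y i k ^+ 2.
  by rewrite [RHS]exchange_big; apply: eq_bigr => i _; rewrite E1 mulr_sumr.
have -> : \sum_(i | P i) \sum_(j | P j) lam i * lam j * sqnorm (z i - z j) =
    \sum_(k < d) \sum_(i | P i) \sum_(j | P j) lam i * lam j * (y i k - y j k) ^+ 2.
  rewrite [RHS]exchange_big/=; apply: eq_bigr => i _.
  rewrite [RHS]exchange_big/=; apply: eq_bigr => j _.
  by rewrite E2 mulr_sumr.
rewrite E3 E4 mulr_sumr -sumrB mulr_sumr; apply: eq_bigr => k _.
set L := \sum_(i | P i) lam i; set S1 := \sum_(i | P i) lam i * y i k.
set S2 := \sum_(i | P i) lam i * y i k ^+ 2.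
transitivity (\sum_(i | P i) lam i * (y i k ^+ 2 * L - 2 * y i k * S1 + S2)).
  apply: eq_bigr => i _.
  rewrite /L /S1 /S2 !mulr_sumr -sumrB -big_split/= mulr_sumr.
  by apply: eq_bigr => j _; move: (lam i) (lam j) (y i k) (y j k) => a b u v; ring.
transitivity (S2 * L - 2 * S1 * S1 + S2 * L); last by ring.
transitivity (\sum_(i | P i) (lam i * y i k ^+ 2 * L - 2 * S1 * (lam i * y i k) + S2
    * lam i)).
  by apply: eq_bigr => i _; ring.
by rewrite big_split sumrB/= -mulr_suml -!mulr_sumr.
Qed.

End EuclideanNorm.

(** * Convexity and Young inequalities for powers *)

Section PowerInequalities.
Context {R : realType}.
Implicit Types p h x y s r : R.

Lemma powR_convex p (t x y : R) : 1 <= p -> 0 <= t <= 1 -> 0 <= x -> 0 <= y ->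
  (t * x + (1 - t) * y) `^ p <= t * x `^ p + (1 - t) * y `^ p.
Proof.
move=> p1 /andP[t0 t1] x0 y0.
have := @convex_powR R p p1 (Itv01 t0 t1) x y.
rewrite !inE /= !in_itv/= !andbT => /(_ x0 y0).
by rewrite !convRE.
Qed.

(** [x + y] is the convex combination of [(1 + e) * x] and [(1 + e) / e * y] with weights
    [1 / (1 + e)] and [e / (1 + e)]; each weight cancels one factor of the power. *)
Lemma powRD_split p (e x y : R) : 1 <= p -> 0 < e -> 0 <= x -> 0 <= y ->
  (x + y) `^ p <= (1 + e) `^ (p - 1) * x `^ p
                  + ((1 + e) / e) `^ (p - 1) * y `^ p.
Proof.
move=> p1 e0 x0 y0.
have e1 : 0 < 1 + e by lra.
have H (a z : R) : 0 < a -> 0 <= z -> a^-1 * (a * z) `^ p = a `^ (p - 1) * z `^ p.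
  move=> a0 z0; have a0' := ltW a0; have p0 : 0 < p by lra.
  by rewrite (powRM _ a0' z0) -(mulr_powRB1 a0' p0) !mulrA mulVf ?gt_eqF// mul1r.
have := @powR_convex p (1 + e)^-1 ((1 + e) * x) ((1 + e) / e * y) p1.
have -> : 1 - (1 + e)^-1 = ((1 + e) / e)^-1 by field; rewrite !gt_eqF.
rewrite !H ?divr_gt0// !mulKf ?gt_eqF ?divr_gt0//; apply.
- by rewrite invr_ge0 ltW//= invf_le1//; lra.
- by rewrite mulr_ge0// ltW.
- by rewrite mulr_ge0// divr_ge0// ltW.
Qed.

(** [1 + h] is the convex combination of 2 and 1 with weight [h] on 2. *)
Lemma powR_1D_le p h : 1 <= p -> 0 <= h <= 1 -> (1 + h) `^ p <= 1 + 2 `^ p * h.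
Proof.
move=> p1 h01; have := @powR_convex p h 2 1 p1 h01.
rewrite powR1 (_ : h * 2 + (1 - h) * 1 = 1 + h); last by ring.
by move=> /(_ ltac:(lra) ltac:(lra)) H; rewrite (le_trans H)//; lra.
Qed.

(** Young's inequality for the product of [(r / s) ^ p] and 1 with exponents [q / p] and
    [q / (q - p)], scaled by [s ^ p]. It trades [p] for the even exponent [q = 2 l]. *)
Lemma powR_young p (l : nat) r s : 0 < p -> p < (2 * l)%:R -> 0 <= r -> 0 < s ->
  r `^ p <= p / (2 * l)%:R * (s `^ (p - (2 * l)%:R) * r ^+ (2 * l))
            + (1 - p / (2 * l)%:R) * s `^ p.
Proof.
set q := (2 * l)%:R => p0 pq r0 s0.
have q0 : 0 < q by lra.
have := @conjugate_powR R ((r / s) `^ p) 1 (q / p) (q / (q - p)).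
rewrite powR1 mulr1 -powRrM [p * _]mulrC divfK ?gt_eqF//.
rewrite !invf_div mul1r => /(_ (powR_ge0 _ _) ler01).
have qp0 : 0 < q - p by lra.
move=> /(_ (divr_gt0 q0 p0) (divr_gt0 q0 qp0)).
have -> : p / q + (q - p) / q = 1 by rewrite -mulrDl subrKC divff ?gt_eqF.
move=> /(_ erefl) H.
have sp : 0 < s `^ p by exact: powR_gt0.
have E a : r `^ a = s `^ a * (r / s) `^ a.
  by rewrite -powRM ?divr_ge0 ?(ltW s0)// mulrC divfK// gt_eqF.
rewrite E -(powR_mulrn (2 * l) r0) -/q E.
have -> : s `^ (p - q) * (s `^ q * (r / s) `^ q) = s `^ p * (r / s) `^ q.
  by rewrite mulrA -powRD ?subrK// gt_eqF ?implybT.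
rewrite (le_trans (ler_wpM2l (ltW sp) H))// le_eqVlt; apply/orP; left; apply/eqP.
rewrite mulrBl divff ?gt_eqF//; ring.
Qed.

(** The induction step multiplies the hypothesis by [y] and adds the nonnegative term
    [(l + 1) x^l (x - y)^2]. *)
Lemma exprn_young (l : nat) (x y : R) : 0 <= x -> 0 <= y ->
  l.+1%:R * (x ^+ l * y) <= l%:R * x ^+ l.+1 + y ^+ l.+1.
Proof.
move=> x0 y0; elim: l => [|l IH]; first by rewrite !expr0 !expr1; lra.
have H1 := ler_wpM2r y0 IH.
have H2 : 0 <= l.+1%:R * (x ^+ l * (x - y) ^+ 2).
  by rewrite mulr_ge0// mulr_ge0 ?sqr_ge0// exprn_ge0.
move: H1 H2; rewrite !(exprS _ l.+1) !(exprS _ l) -!natr1.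
set X := x ^+ l; set Y := y ^+ l; set n : R := l%:R; nra.
Qed.

End PowerInequalities.

(** * Minimizers of even-power energies *)

Section PowerMean.
Context {R : realType} {d : nat} {I : finType}.
Variables (P : pred I) (W : I -> R) (b : I -> 'rV[R]_d) (l : nat).
Hypothesis W_ge0 : forall i, P i -> 0 <= W i.

(** The exponent of the distance is [2 l], so the energy is polynomial in [c] and differentiable
    even where [c] meets some [b i]. *)
Let energy (c : 'rV[R]_d) : R := \sum_(i | P i) W i * sqnorm (b i - c) ^+ l.

Lemma energy_continuous : continuous energy.
Proof.
have Hk (x y : 'rV[R]_d) k : (x - z) ord0 k ^+ 2 @[z --> y] --> (x - y) ord0 k ^+ 2.
  have H : (x - z) ord0 k @[z --> y] --> (x - y) ord0 k.
    rewrite (_ : (fun _ => _) = fun z : 'rV[R]_d => x ord0 k - z ord0 k); last first.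
      by apply/funext => z; rewrite !mxE.
    rewrite !mxE; apply: (@cvgB R R^o _ (nbhs y) _ (fun=> x ord0 k) (fun z : 'rV[R]_d
        => z ord0 k)).
      exact: cvg_cst.
    exact: coord_continuous.
  by rewrite expr2; apply: (@cvgM R _ (nbhs y) _ (fun z => (x - z) ord0 k) (fun z =>
      (x - z) ord0 k)).
have Hs x : continuous (fun y : 'rV[R]_d => sqnorm (x - y)).
  by apply: continuous_big => [|k _ y]; [exact: add_continuous|exact: Hk].
apply: continuous_big => [|i _ c]; first exact: add_continuous.
apply: (@cvgM R _ (nbhs c) _ (fun=> W i) (fun y => sqnorm (b i - y) ^+ l));
    first exact: cvg_cst.
apply: (@cvg_comp _ _ _ (fun y => sqnorm (b i - y)) (fun x : R => x ^+ l) _ (nbhs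
    (sqnorm (b i - c)))).
  exact: Hs.
exact: exprn_continuous.
Qed.

(* Clamping to a box that contains all the [b i] does not increase the energy,
   so a minimizer over the box is a global one. *)
Lemma energy_minimizer : exists c, forall c', energy c <= energy c'.
Proof.
pose M := \sum_i \sum_k `|b i ord0 k|.
have bM i k : `|b i ord0 k| <= M.
  rewrite /M (bigD1 i)//= (bigD1 k)//= -addrA lerDl addr_ge0//.
    by apply: sumr_ge0.
  by apply: sumr_ge0 => j _; apply: sumr_ge0.
have M0 : 0 <= M by apply: sumr_ge0 => i _; apply: sumr_ge0.
pose box := [set v : 'rV[R]_d | forall i, `[- M, M]%classic (v ord0 i)].
have cbox : compact box.
  by apply: (@rV_compact _ _ (fun=> `[- M, M]%classic)) => _; apply: segment_compact.
have box0 : box !=set0 by exists 0 => k; rewrite /= mxE in_itv/= M0 oppr_le0 M0.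
have [|c _ cmin] := @EVT_min_rV R d energy box box0 cbox.
  by apply: continuous_subspaceT => x; exact: energy_continuous.
exists c => c'.
pose c'' : 'rV[R]_d := \row_k Num.max (- M) (Num.min M (c' ord0 k)).
rewrite (le_trans (cmin c'' _))//.
  by rewrite inE => k /=; rewrite mxE in_itv/= le_max lexx/= ge_max ge_min lexx ge0_cp.
apply: ler_sum => i Pi; rewrite ler_wpM2l ?W_ge0//.
apply: lerXn2r; rewrite ?nnegrE ?sqnorm_ge0//.
apply: ler_sum => k _; rewrite !mxE.
rewrite -[leLHS]real_normK ?num_real// -[leRHS]real_normK ?num_real//.
apply: lerXn2r; rewrite ?nnegrE//.
have := bM i k; rewrite ler_norml => /andP[h1 h2].
rewrite /Num.max /Num.min.
have [h3|h3] := ltP M (c' ord0 k).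
  have [h4|h4] := ltP (- M) M; rewrite ler_norml; apply/andP; split;
  have := ler_norm (b i ord0 k - c' ord0 k);
      have := ler_norm (- (b i ord0 k - c' ord0 k)); rewrite normrN; lra.
have [h4|h4] := ltP (- M) (c' ord0 k) => //.
rewrite ler_norml; apply/andP; split;
  have := ler_norm (b i ord0 k - c' ord0 k);
      have := ler_norm (- (b i ord0 k - c' ord0 k)); rewrite normrN; lra.
Qed.

(** All partial derivatives vanish at a minimizer. Thus [c] is a barycenter of the [b i], for
    weights that depend on [c] itself. *)
Lemma energy_first_order (c : 'rV[R]_d) : (0 < l)%N -> (forall c', energy c <= energy c') ->
  \sum_(i | P i) (W i * sqnorm (b i - c) ^+ l.-1) *: (b i - c) = 0.
Proof.
move=> l0 cmin; apply/rowP => k; rewrite summxE mxE.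
pose u : 'rV[R]_d := delta_mx ord0 k.
pose x i : R := (b i - c) ord0 k.
pose Q i : {poly R} := (sqnorm (b i - c))%:P - (2 * x i) *: 'X + 'X ^+ 2.
have QE i t : (Q i).[t] = sqnorm (b i - (c + t *: u)).
  rewrite /Q !hornerE opprD addrA [RHS]sqnormD -[- (t *: u)]scaleNr sqnormZ.
  have -> : sqnorm u = 1.
    rewrite /sqnorm (bigD1 k)//= mxE !eqxx expr1n big1 ?addr0// => j jk.
    by rewrite mxE (negPf jk) expr0n.
  have -> : dot (b i - c) (- t *: u) = - t * x i.
    rewrite /dot (bigD1 k)//= -/(x i) big1 ?addr0.
      by rewrite mxE [u _ _]mxE !eqxx mulr1 mulrC.
    by move=> j jk; rewrite !mxE eqxx (negPf jk)/= !mulr0.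
  by rewrite /GRing.scale/=; ring.
(* On the line through [c] with direction [u] the energy is a polynomial in the parameter, minimal
   at 0. *)
pose G : {poly R} := \sum_(i | P i) W i *: Q i ^+ l.
have GE t : G.[t] = energy (c + t *: u).
  rewrite /G horner_sum; apply: eq_bigr => i _.
  by rewrite hornerZ horner_exp QE.
have := @derive1_at_min R (horner G) (-1) 1 0.
have -> : (-1 : R) <= 1 by lra.
move=> /(_ isT (fun t _ => @derivable_horner R G t)).
rewrite in_itv/= ltrN10 ltr01 => /(_ isT) H.
have {}H : is_derive (0 : R) (1 : R) (horner G) 0.
  by apply: H => t _; rewrite !GE scale0r addr0 cmin.
have : (G^`()).[0] = 0 by rewrite derivE derive1E; case: H.
rewrite /G raddf_sum horner_sum/=.
have -> : \sum_(i | P i) (W i *: Q i ^+ l)^`().[0] =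
    - (2 * l%:R) * \sum_(i | P i) ((W i * sqnorm (b i - c) ^+ l.-1) *: (b i - c)) ord0 k.
  rewrite mulr_sumr; apply: eq_bigr => i _.
  rewrite derivZ hornerZ deriv_exp hornerMn hornerM horner_exp QE scale0r addr0.
  rewrite /Q !poly.derivE !hornerE mxE -/(x i) -mulr_natr /=; ring.
have l0' : (l%:R : R) != 0 by rewrite pnatr_eq0 -lt0n.
by move/eqP; rewrite mulf_eq0 oppr_eq0 mulf_eq0 (negPf l0') pnatr_eq0/= => /eqP.
Qed.

End PowerMean.

(** * Subsets of a weighted finite set *)

Section WeightedSums.
Context {R : realType} {I : finType}.
Variable om : I -> R.
Hypothesis om_ge0 : forall i, 0 <= om i.

Lemma ler_sum_orb (P Q : pred I) :
  \sum_(i | P i || Q i) om i <= \sum_(i | P i) om i + \sum_(i | Q i) om i.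
Proof.
rewrite [leLHS]big_mkcond [X in _ <= X + _]big_mkcond [X in _ <= _ + X]big_mkcond/=.
rewrite -big_split/=; apply: ler_sum => i _; have := om_ge0 i.
by case: (P i); case: (Q i) => /=; lra.
Qed.

Lemma light_complement (P : pred I) :
  \sum_(i | P i) om i < \sum_i om i -> exists i, ~~ P i.
Proof.
move=> lt1; have [/existsP//|] := boolP [exists i, ~~ P i].
rewrite negb_exists => /forallP allP; move: lt1.
by rewrite (eq_bigl predT) ?ltxx// => i; have := allP i; rewrite negbK.
Qed.

(** Where [t < s i], also [t <= s i ^ p], because [t >= 1] and [p >= 1]. *)
Lemma powR_markov (s : I -> R) (p K t : R) : 1 <= p -> 1 <= t -> (forall i, 0 <= s i) ->
  forall P : pred I, \sum_(i | P i) om i * s i `^ p <= K ->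
  \sum_(i | P i && (t < s i)) om i <= K / t.
Proof.
move=> p1 t1 s0 P sK; have t0 : 0 < t by lra.
rewrite ler_pdivlMr// (le_trans _ sK)// mulr_suml.
rewrite [leRHS](bigID (fun i => t < s i))/= -[leLHS]addr0 lerD//; last first.
  by apply: sumr_ge0 => i _; rewrite mulr_ge0// powR_ge0.
apply: ler_sum => i /andP[_ ti]; rewrite ler_wpM2l//.
by rewrite (le_trans (ltW ti))// le1r_powR//; lra.
Qed.

End WeightedSums.

(* The averaging argument behind Kirszbraun's theorem, with an error term for
   the pairs in [e]. *)
Lemma kirszbraun_average (R : realType) (I : finType) (d1 d2 : nat)
    (P : pred I) (e : rel I) (lam : I -> R) (a : I -> 'rV[R]_d1)
    (b : I -> 'rV[R]_d2) (u : 'rV[R]_d1) (c : 'rV[R]_d2) (D mx : R) :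
  (forall i, P i -> 0 <= lam i) -> 0 <= D -> 0 <= mx ->
  \sum_(i | P i) lam i *: (b i - c) = 0 ->
  (forall i j, ~~ e i j -> sqnorm (b i - b j) <= sqnorm (a i - a j)) ->
  (forall i j, P i -> P j -> sqnorm (b i - b j) <= D) ->
  (forall i, P i -> \sum_(j | P j && e i j) lam j <= mx) ->
  \sum_(i | P i) lam i * sqnorm (b i - c) <=
  \sum_(i | P i) lam i * sqnorm (a i - u) + D * mx / 2.
Proof.
move=> lam0 D0 mx0 bary lip bD small.
set L := \sum_(i | P i) lam i.
have L_ge0 : 0 <= L by exact: sumr_ge0.
have [L0|Lneq0] := eqVneq L 0.
  have lamz i : P i -> lam i = 0.
    by move=> Pi; have /eqP := L0; rewrite psumr_eq0// => /allP/(_ i);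
        rewrite mem_index_enum Pi => /(_ isT)/eqP.
  rewrite !big1 ?add0r; last 2 first.
  - by move=> i /lamz ->; rewrite mul0r.
  - by move=> i /lamz ->; rewrite mul0r.
  by rewrite divr_ge0// mulr_ge0.
have L_gt0 : 0 < L by rewrite lt0r Lneq0.
have Eb := sum_sqnorm_pairs I P lam b c.
have Ea := sum_sqnorm_pairs I P lam a u.
rewrite bary (_ : sqnorm 0 = 0) in Eb; last first.
  by rewrite /sqnorm big1// => i _; rewrite mxE expr0n.
have sa := sqnorm_ge0 (\sum_(i | P i) lam i *: (a i - u)).
(* Pairs outside [e] do not expand from [a] to [b]. A pair in [e] costs at most [lam i * lam j * D],
   and the partners of each [i] weigh at most [mx]. *)
have key : \sum_(i | P i) \sum_(j | P j) lam i * lam j * sqnorm (b i - b j) <=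
    \sum_(i | P i) \sum_(j | P j) lam i * lam j * sqnorm (a i - a j) + L * (D * mx).
  rewrite mulr_suml -big_split/=; apply: ler_sum => i Pi.
  apply: (@le_trans _ _ (\sum_(j | P j) (lam i * lam j * sqnorm (a i - a j)
       + lam i * D * (if e i j then lam j else 0)))).
    apply: ler_sum => j Pj; have ll : 0 <= lam i * lam j by rewrite mulr_ge0 ?lam0.
    have [eij|neij] := boolP (e i j); last by rewrite mulr0 addr0 ler_wpM2l// lip.
    rewrite [X in _ <= _ + X]mulrAC -[leLHS]add0r lerD//;
        first by rewrite mulr_ge0// sqnorm_ge0.
    by rewrite ler_wpM2l// bD.
  rewrite big_split/= lerD2l -mulr_sumr -big_mkcondr/= -mulrA ler_wpM2l ?lam0//.
  by rewrite ler_wpM2l// small.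
rewrite Eb Ea subr0 in key.
rewrite -(ler_pM2l L_gt0); rewrite -/L in key; lra.
Qed.

(** Bounds the error that bad pairs cause in the averaging argument. Since [p >= 2 q], the
    hypothesis on [th] supplies [h ^ (10 q + 5)], which absorbs the negative powers of [h] and
    leaves [7.68 h (q + 1) (2304 h^8)^q], where [2304 = 48^2]. *)
Lemma robust_extension_numeric (R : realType) (q : nat) (p h th : R) :
  (2 * q)%:R <= p -> 0 < h -> h <= 1 / 10 -> th <= h `^ (5 * (p + 1)) / 150 ->
  q.+1%:R / 2 * (48 / h) ^+ (2 * q.+1) * (th / h ^+ 2) <= 8 * h.
Proof.
move=> qp h0 h1 thh.
have h_neq0 : h != 0 by rewrite gt_eqF.
have thq : th <= h ^+ (10 * q + 5) / 150.
  rewrite (le_trans thh)// ler_pM2r ?invr_gt0//.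
  rewrite -powR_mulrn ?(ltW h0)// ger_powR ?h0//=; last first.
    by move: qp; rewrite natrD !natrM; lra.
  lra.
have -> : 8 * h = q.+1%:R / 2 * (48 / h) ^+ (2 * q.+1) * (h ^+ (10 * q + 5) / 150 / h
    ^+ 2) +
    (8 * h - q.+1%:R / 2 * (48 / h) ^+ (2 * q.+1) * (h ^+ (10 * q + 5) / 150 / h ^+
        2)) by ring.
rewrite -[leLHS]addr0 lerD//.
  rewrite ler_wpM2l ?ler_pM2r ?invr_gt0 ?exprn_gt0//.
  by rewrite mulr_ge0// ?exprn_ge0 ?divr_ge0 ?(ltW h0)//.
rewrite subr_ge0.
have -> : q.+1%:R / 2 * (48 / h) ^+ (2 * q.+1) * (h ^+ (10 * q + 5) / 150 / h ^+ 2) =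
    (2304 / 300) * h * (q.+1%:R * (2304 * h ^+ 8) ^+ q).
  pose A := (48 : R) ^+ q ^+ 2; pose C2 := h ^+ q ^+ 2; pose C8 := h ^+ q ^+ 8.
  have -> : (48 / h) ^+ (2 * q.+1) = A * 2304 / (C2 * h ^+ 2).
    rewrite mulnS addnC exprD [(2 * q)%N]mulnC exprM exprMn exprVn !exprMn !exprVn.
    rewrite (_ : 2304 = 48 ^+ 2 :> R); last by ring.
    exact: mulf_div.
  have -> : h ^+ (10 * q + 5) = C8 * C2 * (h ^+ 2 * h ^+ 2 * h).
    by rewrite exprD [(10 * q)%N]mulnC exprM (exprD (h ^+ q) 8 2); congr (_ * _); ring.
  have -> : (2304 * h ^+ 8) ^+ q = A * C8.
    rewrite exprMn -exprM [(8 * q)%N]mulnC exprM -/C8 (_ : 2304 = 48 ^+ 2 :> R);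
        last by ring.
    by rewrite -exprM [(2 * q)%N]mulnC exprM.
  have fieldE (qq x A' C2' C8' h2 : R) : C2' != 0 -> h2 != 0 ->
      qq / 2 * (A' * 2304 / (C2' * h2)) * (C8' * C2' * (h2 * h2 * x) / 150 / h2) =
      (2304 / 300) * x * (qq * (A' * C8')).
    by move=> h1' h2'; field; rewrite h1' h2'.
  by apply: fieldE; rewrite !expf_neq0.
(* As [h <= 1 / 10], the base is at most [1 / 2], and [q + 1 <= 2 ^ q]. *)
have hq : q.+1%:R * (2304 * h ^+ 8) ^+ q <= 1.
  have h8 : 2304 * h ^+ 8 <= 2^-1.
    have : h ^+ 8 <= (1 / 10) ^+ 8 by apply: lerXn2r; rewrite ?nnegrE ?(ltW h0)//; lra.
    by move: (h ^+ 8) => x; lra.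
  have x0 : 0 <= 2304 * h ^+ 8.
    by have := exprn_ge0 8 (ltW h0); move: (h ^+ 8) => x; lra.
  move: h8 x0; move: (2304 * h ^+ 8) => x h8 x0.
  have : x ^+ q <= 2^-1 ^+ q by apply: lerXn2r; rewrite ?nnegrE.
  move=> H; rewrite (le_trans (ler_wpM2l _ H))// exprVn ler_pdivrMr ?exprn_gt0// mul1r.
  by rewrite -natrX ler_nat ltn_expl.
have := ler_wpM2l (ltW h0) hq; lra.
Qed.

(** * Robust extension *)

Section RobustExtension.
Context {R : realType} {I : finType} {d1 d2 : nat}.
Variables (a : I -> 'rV[R]_d1) (b : I -> 'rV[R]_d2) (om : I -> R) (e : rel I).
Variables (p h th : R) (u : 'rV[R]_d1).
Hypotheses (p1 : 1 <= p) (h0 : 0 < h) (h1 : h <= 1 / 10) (th0 : 0 <= th).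
Hypothesis thh : th <= h `^ (5 * (p + 1)) / 150.
Hypothesis om_ge0 : forall i, 0 <= om i.
Hypothesis om_sum : \sum_i om i = 1.
Hypothesis lip : forall i j, ~~ e i j -> enorm (b i - b j) <= enorm (a i - a j).
Hypothesis e_small : forall i, \sum_(j | e i j) om j <= th.

Let s i := enorm (a i - u).
Hypothesis cost1 : \sum_i om i * s i `^ p <= 1.

Let s_ge0 i : 0 <= s i. Proof. exact: enorm_ge0. Qed.

Let th_small : th <= 1 / 150.
Proof.
rewrite (le_trans thh)// ler_pM2r ?invr_gt0//.
rewrite -[leRHS](powRr0 h) ger_powR ?h0//=; move: p1 h0 h1; lra.
Qed.

Local Ltac hlra := move: p1 h0 h1 th_small; lra.

(* Pivots: most of the mass lies within distance 2 of [u], and no point has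
   many bad partners, so two points can be compared through a third one. *)
Lemma good_pivot (Q : pred I) (x : R) : x <= 1 / 4 -> \sum_(i | Q i) om i <= x ->
  exists k, ~~ Q k /\ s k <= 2.
Proof.
move=> x4 Qx.
have h2 : \sum_(i | 2 < s i) om i <= 1 / 2.
  exact: (@powR_markov _ _ om om_ge0 s p 1 2 p1 ltac:(hlra) s_ge0 predT cost1).
have [|k] := @light_complement _ _ om (fun i => Q i || (2 < s i)).
  rewrite om_sum; have := ler_sum_orb om om_ge0 Q (fun i => 2 < s i); hlra.
by rewrite negb_or -leNgt => /andP[nQ sk]; exists k.
Qed.

Lemma dist_pivot i k : ~~ e i k -> s k <= 2 -> enorm (b i - b k) <= s i + 2.
Proof.
move=> neik sk; rewrite (le_trans (lip _ _ neik))// (le_trans (enorm_dist u _ _))//.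
by rewrite lerD2l enormB.
Qed.

Lemma dist_any i j : enorm (b i - b j) <= s i + s j + 4.
Proof.
have [|k [nk sk]] := good_pivot (fun k => e i k || e j k) (th + th) ltac:(hlra).
  by rewrite (le_trans (ler_sum_orb om om_ge0 _ _))// lerD.
move: nk; rewrite negb_or => /andP[ni nj].
rewrite (le_trans (enorm_dist (b k) _ _))// (enormB (b k)).
by have := dist_pivot _ _ ni sk; have := dist_pivot _ _ nj sk; hlra.
Qed.

(** A far point has [h * s i > 12], which pays for a detour through a pivot within 2 of [u] and
    within 10 of the center. *)
Let L := 12 / h.
Let near i := s i <= L.
(** Truncated from below because it is raised to a negative power in the weights. *)
Let sp i := Num.max (s i) h.

Let sp_ge i : h <= sp i. Proof. by rewrite le_max lexx orbT. Qed.
Let sp_gt0 i : 0 < sp i. Proof. exact: lt_le_trans (sp_ge i). Qed.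
Let L_ge : 120 <= L.
Proof. by rewrite /L ler_pdivlMr//; hlra. Qed.

(** * Costs around the weighted barycenter *)

Section Center.
Variables (q : nat) (c : 'rV[R]_d2).
Hypotheses (qp : (2 * q)%:R <= p) (pq : p < (2 * q.+1)%:R).
(* The weights [W] turn the exponent [p] into the even integer [2 * q.+1], for
   which the minimizer of the energy satisfies [bary]; [lam] is the weight of
   [b i] in that first-order condition. *)
Let W i := om i * sp i `^ (p - (2 * q.+1)%:R).
Let r i := enorm (b i - c).
Let lam i := W i * sqnorm (b i - c) ^+ q.
Hypothesis bary : \sum_(i | near i) lam i *: (b i - c) = 0.

Let W_ge0 i : 0 <= W i. Proof. by rewrite mulr_ge0// powR_ge0. Qed.
Let lam_ge0 i : 0 <= lam i.
Proof. by rewrite mulr_ge0// exprn_ge0// sqnorm_ge0. Qed.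
Let r_ge0 i : 0 <= r i. Proof. exact: enorm_ge0. Qed.

Local Ltac qlra := move: p1 h0 h1 th_small qp pq; lra.

Lemma near_dist i j : near i -> near j -> enorm (b i - b j) <= 4 * L.
Proof. by rewrite /near => ni nj; have := dist_any i j; move: L_ge; qlra. Qed.

(** The barycenter is within [4 * L] of every near [b j]: multiplied by the total weight, [b j - c]
    is the weighted sum of the [b j - b i]. If the total weight is zero, so is [lam j]. *)
Lemma lam_le j : near j -> lam j <= W j * (4 * L) ^+ (2 * q).
Proof.
move=> nj; have L0 : 0 <= 4 * L by move: L_ge; qlra.
have [z|nz] := eqVneq (\sum_(i | near i) lam i) 0.
  suff -> : lam j = 0 by rewrite mulr_ge0// exprn_ge0.
  have /eqP := z; rewrite psumr_eq0// => /allP/(_ j).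
  by rewrite mem_index_enum nj => /(_ isT)/eqP.
have lgt0 : 0 < \sum_(i | near i) lam i by rewrite lt0r nz sumr_ge0.
rewrite ler_wpM2l// -sqr_enorm -exprM; apply: lerXn2r; rewrite ?nnegrE ?enorm_ge0//.
rewrite -/(r j) -(ler_pM2l lgt0).
have -> : (\sum_(i | near i) lam i) * r j = enorm (\sum_(i | near i) lam i *: (b j - b i)).
  transitivity (enorm ((\sum_(i | near i) lam i) *: (b j - c))).
    by rewrite enormZ ger0_norm// ltW.
  congr enorm.
  transitivity (\sum_(i | near i) (lam i *: (b j - c) - lam i *: (b i - c))).
    by rewrite sumrB bary subr0 scaler_suml.
  by apply: eq_bigr => i _; rewrite -scalerBr opprB addrA subrK.
rewrite (le_trans (enorm_sum _ _ _))// mulr_suml; apply: ler_sum => i ni.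
by rewrite enormZ ger0_norm// ler_wpM2l// near_dist.
Qed.

(** The exponent [2 (q + 1) - p] lies between 0 and 2, while [sp j >= h] and [h <= 1]. *)
Lemma W_le j : W j <= om j * h ^- 2.
Proof.
rewrite ler_wpM2l//.
have hx : 0 <= (2 * q.+1)%:R - p by qlra.
have -> : p - (2 * q.+1)%:R = - ((2 * q.+1)%:R - p) by ring.
rewrite powRN lef_pV2 ?posrE ?powR_gt0 ?exprn_gt0//.
apply: (@le_trans _ _ (h `^ ((2 * q.+1)%:R - p))).
  rewrite -powR_mulrn ?(ltW h0)// ger_powR ?h0//=; first by qlra.
  by move: qp; rewrite mulnS natrD; qlra.
by apply: ge0_ler_powR; rewrite ?nnegrE// ltW.
Qed.

Let mx := th * h ^- 2 * (4 * L) ^+ (2 * q).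

Lemma lam_small i : \sum_(j | near j && e i j) lam j <= mx.
Proof.
have L0 : 0 <= 4 * L by move: L_ge; qlra.
apply: (@le_trans _ _ (\sum_(j | near j && e i j) om j * (h ^- 2 * (4 * L) ^+ (2 * q)))).
  apply: ler_sum => j /andP[nj _]; rewrite (le_trans (lam_le _ nj))// [leRHS]mulrA.
  by rewrite ler_wpM2r ?exprn_ge0// W_le.
rewrite -mulr_suml /mx -mulrA ler_wpM2r//.
  by rewrite mulr_ge0 ?exprn_ge0// invr_ge0 exprn_ge0// ltW.
rewrite (le_trans _ (e_small i))// [leRHS](bigID near)/= -[leLHS]addr0 lerD ?sumr_ge0//.
by under eq_bigl do rewrite andbC.
Qed.

Let V := \sum_(i | near i) om i * sp i `^ p.

(** Let [Y] be the left side, which is the sum of [lam i * r i ^ 2]. Averaging bounds it by the sum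
    of [lam i * s i ^ 2] plus an error, and Young bounds [q + 1] times that sum by [q Y + V].
    Cancelling [q Y] leaves [V] plus [q + 1] times the error. *)
Lemma energy_le : \sum_(i | near i) W i * r i ^+ (2 * q.+1) <= V + 8 * h.
Proof.
set Y := \sum_(i | near i) _.
have L0 : 0 <= 4 * L by move: L_ge; qlra.
have YE : Y = \sum_(i | near i) lam i * sqnorm (b i - c).
  by apply: eq_bigr => i _; rewrite /lam -mulrA -exprSr exprM sqr_enorm.
have HK : Y <= \sum_(i | near i) lam i * sqnorm (a i - u) + (4 * L) ^+ 2 * mx / 2.
  rewrite YE; apply: (@kirszbraun_average _ _ _ _ near e) => //.
  - exact: exprn_ge0.
  - by rewrite /mx !mulr_ge0 ?exprn_ge0// invr_ge0 exprn_ge0// ltW.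
  - move=> i j nij; rewrite -!sqr_enorm; apply: lerXn2r; rewrite ?nnegrE ?enorm_ge0//.
    exact: lip.
  - move=> i j ni nj; rewrite -!sqr_enorm; apply: lerXn2r; rewrite ?nnegrE ?enorm_ge0//.
    exact: near_dist.
  - by move=> i _; exact: lam_small.
have HY : q.+1%:R * (\sum_(i | near i) lam i * sqnorm (a i - u)) <= q%:R * Y + V.
  rewrite /Y /V !mulr_sumr -big_split/=; apply: ler_sum => i _.
  have sps : sqnorm (a i - u) <= sp i ^+ 2.
    rewrite -sqr_enorm; apply: lerXn2r; rewrite ?nnegrE ?enorm_ge0// ?(ltW (sp_gt0 _))//.
    by rewrite le_max lexx.
  have -> : om i * sp i `^ p = W i * (sp i ^+ 2) ^+ q.+1.
    rewrite -exprM /W -mulrA -powR_mulrn ?(ltW (sp_gt0 _))// -powRD ?subrK//.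
    by rewrite (gt_eqF (sp_gt0 i)) implybT.
  rewrite (le_trans (ler_wpM2l _ (ler_wpM2l (lam_ge0 i) sps)))// /lam.
  rewrite exprM sqr_enorm.
  have := ler_wpM2l (W_ge0 i) (@exprn_young R q _ _ (sqnorm_ge0 (b i - c)) (sqr_ge0
      (sp i))).
  by rewrite mulrDr; qlra.
have num := @robust_extension_numeric R q p h th qp h0 h1 thh.
have E : q.+1%:R * ((4 * L) ^+ 2 * mx / 2) = q.+1%:R / 2 * (48 / h) ^+ (2 * q.+1) *
    (th / h ^+ 2).
  have -> : 48 / h = 4 * L by rewrite /L mulrA; congr (_ / _); ring.
  by rewrite /mx mulnS exprD; ring.
have := ler_wpM2l (ler0n R q.+1) HK; rewrite mulrDr E -natr1 in HY num *.
move: num HY; rewrite -natr1; set N := _ / _ * _ * _; qlra.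
Qed.

(** Young's inequality with [s = sp i] removes the weights and returns to exponent [p]; this costs
    at most [8 * h]. Replacing [sp i] by [s i] costs another [h], since [h ^ p <= h]. *)
Lemma near_cost : \sum_(i | near i) om i * r i `^ p <= \sum_(i | near i) om i * s i
    `^ p + 9 * h.
Proof.
have q0 : 0 < (2 * q.+1)%:R :> R by qlra.
set k := p / (2 * q.+1)%:R.
have k0 : 0 <= k by rewrite divr_ge0//; qlra.
have k1 : k <= 1 by rewrite ler_pdivrMr// mul1r ltW.
have H1 : \sum_(i | near i) om i * r i `^ p <=
    k * (\sum_(i | near i) W i * r i ^+ (2 * q.+1)) + (1 - k) * V.
  rewrite /V !mulr_sumr -big_split/=; apply: ler_sum => i _.
  have := ler_wpM2l (om_ge0 i) (@powR_young R p q.+1 (r i) (sp i) ltac:(qlra) pq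
      (r_ge0 i) (sp_gt0 i)).
  by rewrite -/k /W; qlra.
have H2 : V <= \sum_(i | near i) om i * s i `^ p + h.
  apply: (@le_trans _ _ (\sum_(i | near i) om i * s i `^ p + \sum_(i | near i) om i * h)).
    rewrite /V -big_split/=; apply: ler_sum => i _; rewrite -mulrDr ler_wpM2l//.
    have hp : h `^ p <= h.
      by rewrite -[leRHS](powRr1 (ltW h0)) ger_powR ?h0//=; qlra.
    have := powR_ge0 (s i) p; have := powR_ge0 h p.
    by rewrite /sp; case: (leP (s i) h) => _; qlra.
  rewrite lerD2l -mulr_suml -[leRHS]mul1r ler_wpM2r ?(ltW h0)// -om_sum.
  by rewrite [leRHS](bigID near)/= lerDl sumr_ge0.
have HY := energy_le; set Y := \sum_(i | near i) W i * _ in H1 HY.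
have := ler_wpM2l k0 HY; have := ler_wpM2r (ltW h0) k1; qlra.
Qed.

Lemma far_dist i : ~~ near i -> r i <= (1 + h) * s i.
Proof.
move=> fi.
have nc : \sum_(i | near i) om i * r i `^ p <= 2.
  rewrite (le_trans near_cost)//.
  suff : \sum_(i | near i) om i * s i `^ p <= 1 by qlra.
  rewrite (le_trans _ cost1)// [leRHS](bigID near)/= lerDl sumr_ge0// => j _.
  by rewrite mulr_ge0// powR_ge0.
have h10 : \sum_(i | near i && (10 < r i)) om i <= 2 / 10.
  exact: (@powR_markov _ _ om om_ge0 r p 2 10 p1 ltac:(qlra) r_ge0 near nc).
(* The pivot is a good partner of [i], within 2 of [u], and its image is within 10 of [c]. The
   excluded mass is at most [th + 1 / 5 <= 1 / 4]. *)
have [||k [nk sk]] := good_pivot (fun k => e i k || near k && (10 < r k)) (th + 2 / 10).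
- by qlra.
- by rewrite (le_trans (ler_sum_orb om om_ge0 _ _))// lerD.
have neark : near k by rewrite /near; move: L_ge; qlra.
move: nk; rewrite negb_or neark/= -leNgt => /andP[nik rk].
have := enorm_dist (b k) (b i) c; rewrite -/(r i) -/(r k) => H.
have := dist_pivot _ _ nik sk => H'.
have : 12 < h * s i by move: fi; rewrite /near -ltNge /L ltr_pdivrMr// mulrC.
qlra.
Qed.

(** Near points add [9 * h], and far points gain a factor [(1 + h) ^ p <= 1 + 2 ^ p * h]; finally
    [2 ^ p + 9 <= 3 ^ (p + 2)]. *)
Lemma robust_cost : \sum_i om i * r i `^ p <= 1 + 3 `^ (p + 2) * h.
Proof.
rewrite (bigID near)/=.
have far : \sum_(i | ~~ near i) om i * r i `^ p <=
    (1 + 2 `^ p * h) * \sum_(i | ~~ near i) om i * s i `^ p.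
  rewrite mulr_sumr; apply: ler_sum => i fi; rewrite mulrCA ler_wpM2l//.
  apply: (@le_trans _ _ (((1 + h) * s i) `^ p)).
    by apply: ge0_ler_powR; rewrite ?nnegrE ?mulr_ge0 ?far_dist//; qlra.
  rewrite powRM//; last by qlra.
  by rewrite ler_wpM2r ?powR_ge0// powR_1D_le//; qlra.
have := near_cost; have := cost1; rewrite (bigID near)/=; move: far.
set A := \sum_(i | near i) om i * s i `^ p;
    set B := \sum_(i | ~~ near i) om i * s i `^ p => far AB nc.
have A0 : 0 <= A by rewrite sumr_ge0// => i _; rewrite mulr_ge0// powR_ge0.
have B0 : 0 <= B by rewrite sumr_ge0// => i _; rewrite mulr_ge0// powR_ge0.
have p30 : 0 <= 2 `^ p :> R by exact: powR_ge0.
have p23 : 2 `^ p <= 3 `^ p :> R by apply: ge0_ler_powR; rewrite ?nnegrE//; qlra.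
have p33 : 3 <= 3 `^ p :> R by rewrite le1r_powR//; qlra.
have -> : 3 `^ (p + 2) = 9 * 3 `^ p :> R.
  by rewrite powRD ?pnatr_eq0 ?implybT// (powR_mulrn 2)// mulrC; congr (_ * _); ring.
have hB : h * 2 `^ p * B <= h * 2 `^ p * 1.
  by rewrite ler_wpM2l ?mulr_ge0 ?(ltW h0)//; qlra.
have h3 : h * (2 `^ p + 9) <= h * (9 * 3 `^ p) by rewrite ler_wpM2l ?(ltW h0)//; qlra.
qlra.
Qed.

End Center.

Lemma robust_extension : exists c : 'rV[R]_d2,
  \sum_i om i * enorm (b i - c) `^ p <= 1 + 3 `^ (p + 2) * h.
Proof.
(* [2 (q + 1)] is the least even integer strictly above [p]. *)
pose q := Num.truncn (p / 2).
have /andP[q1 q2] : q%:R <= p / 2 < q.+1%:R by apply: truncn_itv; hlra.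
pose W i := om i * sp i `^ (p - (2 * q.+1)%:R).
have W0 i : near i -> 0 <= W i by move=> _; rewrite mulr_ge0// powR_ge0.
have [c cmin] := @energy_minimizer R d2 I near W b q.+1 W0.
exists c; apply: (@robust_cost q).
- by rewrite natrM; hlra.
- by rewrite natrM; hlra.
- exact: (@energy_first_order R d2 I near W b q.+1 c _ cmin).
Qed.

End RobustExtension.

(** * Weighted clustering costs *)

Definition wcost {R : realType} {I : finType} {d : nat} (p : R) (w : I -> R)
    (f : I -> 'rV[R]_d) : R :=
  inf (range (fun c : 'rV[R]_d => \sum_i w i * enorm (f i - c) `^ p)).

Section WeightedCost.
Context {R : realType} {I : finType}.
Variables (p : R) (w : I -> R).
Hypotheses (p1 : 1 <= p) (w_ge0 : forall i, 0 <= w i).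

Lemma wcost_sum_ge0 (r : I -> R) : 0 <= \sum_i w i * r i `^ p.
Proof. by apply: sumr_ge0 => i _; rewrite mulr_ge0// powR_ge0. Qed.

Lemma wcost_le {d} (f : I -> 'rV[R]_d) c :
  wcost p w f <= \sum_i w i * enorm (f i - c) `^ p.
Proof.
apply: ge_inf; last by exists c.
by exists 0 => _ [c' _ <-]; exact: wcost_sum_ge0.
Qed.

Lemma wcost_ge0 {d} (f : I -> 'rV[R]_d) : 0 <= wcost p w f.
Proof.
apply: lb_le_inf; first by eexists; exists 0.
by move=> _ [c' _ <-]; exact: wcost_sum_ge0.
Qed.

Lemma wcost_lt {d} (f : I -> 'rV[R]_d) K : wcost p w f < K ->
  exists c, \sum_i w i * enorm (f i - c) `^ p < K.
Proof.
move/inf_lt => H; have [|_ [c _ <-] cK] := H; last by exists c.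
by eexists; exists 0.
Qed.

(** Replaces the infimum by any larger [K], for which an actual center of cost below [K] exists. *)
Lemma wcost_gtP {d1 d2} (f : I -> 'rV[R]_d1) (g : I -> 'rV[R]_d2) (B C : R) :
  0 < B -> (forall K, wcost p w f < K -> wcost p w g <= B * K + C) ->
  wcost p w g <= B * wcost p w f + C.
Proof.
move=> B0 H; apply/ler_addgt0Pr => e e0.
have := H (wcost p w f + e / B); rewrite ltrDl divr_gt0// => /(_ isT).
by rewrite mulrDr mulrCA divff ?gt_eqF// mulr1 addrAC.
Qed.

Lemma wcost_perturb {d} (eps : R) (f g : I -> 'rV[R]_d) : 0 < eps ->
  wcost p w f <= (1 + eps) `^ (p - 1) * wcost p w g
    + ((1 + eps) / eps) `^ (p - 1) * \sum_i w i * enorm (f i - g i) `^ p.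
Proof.
move=> e0; apply: wcost_gtP; first by rewrite powR_gt0; lra.
move=> K /wcost_lt[c cK]; rewrite (le_trans (wcost_le f c))//.
apply: (@le_trans _ _ ((1 + eps) `^ (p - 1) * (\sum_i w i * enorm (g i - c) `^ p)
    + ((1 + eps) / eps) `^ (p - 1) * \sum_i w i * enorm (f i - g i) `^ p)).
  rewrite !mulr_sumr -big_split/=; apply: ler_sum => i _.
  rewrite mulrCA [X in _ <= _ + X]mulrCA -mulrDr ler_wpM2l//.
  rewrite (le_trans _ (powRD_split _ _ _ _ p1 e0 (enorm_ge0 _) (enorm_ge0 _)))//.
  apply: ge0_ler_powR; rewrite ?nnegrE ?addr_ge0 ?enorm_ge0//; first by move: p1; lra.
  by rewrite [leRHS]addrC enorm_dist.
by rewrite lerD2r ler_wpM2l ?powR_ge0// ltW.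
Qed.

Lemma wcost_robust {d1 d2} (a : I -> 'rV[R]_d1) (b : I -> 'rV[R]_d2)
    (e : rel I) (L h th : R) :
  0 < L -> 0 < h -> h <= 1 / 10 -> 0 <= th -> th <= h `^ (5 * (p + 1)) / 150 ->
  (forall i j, ~~ e i j -> enorm (b i - b j) <= L * enorm (a i - a j)) ->
  (forall i, \sum_(j | e i j) w j <= th * \sum_j w j) ->
  wcost p w b <= L `^ p * (1 + 3 `^ (p + 2) * h) * wcost p w a.
Proof.
move=> L0 h0 h1 th0 thh lip small.
have B0 : 0 < L `^ p * (1 + 3 `^ (p + 2) * h).
  by rewrite mulr_gt0 ?powR_gt0// ltr_pwDl// mulr_ge0 ?powR_ge0// ltW.
rewrite -[leRHS]addr0; apply: wcost_gtP => // K aK; rewrite addr0.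
have K0 : 0 < K by exact: le_lt_trans (wcost_ge0 a) aK.
set W := \sum_j w j in small.
have [W0|Wn0] := eqVneq W 0.
  have wz i : w i = 0.
    have /eqP := W0; rewrite psumr_eq0// => /allP/(_ i).
    by rewrite mem_index_enum => /(_ isT)/eqP.
  rewrite (le_trans (wcost_le b 0))// big1.
    exact: mulr_ge0 (ltW B0) (ltW K0).
  by move=> i _; rewrite wz mul0r.
have W0 : 0 < W by rewrite lt0r Wn0 sumr_ge0.
have p0 : 0 < p by move: p1; lra.
have /wcost_lt[u uK] := aK.
(* Dividing the weights by [W], [a] by [sg] and [b] by [L * sg] makes the mass 1, the cost at most 1
   and the Lipschitz constant 1. *)
pose sg := (K / W) `^ p^-1.
have sg0 : 0 < sg by rewrite powR_gt0// divr_gt0.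
have sgp : sg `^ p = K / W.
  by rewrite -powRrM mulVf ?gt_eqF// powRr1// ltW// divr_gt0.
have Ls0 : 0 < L * sg by rewrite mulr_gt0.
have powZ (x : R) m (z : 'rV[R]_m) : 0 < x -> enorm (x^-1 *: z) `^ p = enorm z `^ p /
    x `^ p.
  move=> x0; rewrite enormZ gtr0_norm ?invr_gt0// powRM ?enorm_ge0 ?invr_ge0 ?(ltW x0)//.
  by rewrite -powR_inv1 ?(ltW x0)// powRAC powR_inv1 ?powR_ge0// mulrC.
have [|||||c hc] := @robust_extension R I d1 d2 (fun i => sg^-1 *: a i) (fun i => (L
    * sg)^-1 *: b i)
  (fun i => w i / W) e p h th (sg^-1 *: u) p1 h0 h1 th0 thh.
- by move=> i; rewrite divr_ge0// ltW.
- by rewrite -mulr_suml divff// gt_eqF.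
- move=> i j /lip H; rewrite -!scalerBr !enormZ !gtr0_norm ?invr_gt0//.
  by rewrite invfM mulrAC [leRHS]mulrC ler_pM2r ?invr_gt0// ler_pdivrMl.
- by move=> i; rewrite -mulr_suml ler_pdivrMr.
- under eq_bigr do rewrite -scalerBr powZ// sgp mulrACA.
  rewrite -mulr_suml invf_div mulKf// ler_pdivrMr// mul1r ltW//.
rewrite (le_trans (wcost_le b ((L * sg) *: c)))//.
have bc i : b i - (L * sg) *: c = (L * sg) *: ((L * sg)^-1 *: b i - c).
  by rewrite scalerBr scalerA divff ?gt_eqF// scale1r.
under eq_bigr do rewrite bc enormZ gtr0_norm// powRM ?(ltW Ls0) ?enorm_ge0// mulrCA.
rewrite -mulr_sumr powRM ?(ltW L0) ?(ltW sg0)// sgp -!mulrA ler_wpM2l ?powR_ge0//.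
rewrite [leRHS]mulrC ler_wpM2l ?(ltW K0)//.
rewrite mulr_sumr; under eq_bigr do rewrite mulrA [_^-1 * _]mulrC.
exact: hc.
Qed.

(** With [h = alpha ^ (1 / (p + 1))], the allowed fraction [h ^ (5 (p + 1)) / 150] becomes
    [alpha ^ 5 / 150], and the bound on [alpha] says [h <= 1 / 10]. *)
Lemma wcost_robust_alpha {d1 d2} (a : I -> 'rV[R]_d1) (b : I -> 'rV[R]_d2)
    (e : rel I) (L alpha : R) :
  0 < L -> 0 <= alpha -> alpha <= (10 `^ (p + 1))^-1 ->
  (forall i j, ~~ e i j -> enorm (b i - b j) <= L * enorm (a i - a j)) ->
  (forall i, \sum_(j | e i j) w j <= alpha ^+ 5 / 150 * \sum_j w j) ->
  wcost p w b <= L `^ p * (1 + 3 `^ (p + 2) * alpha `^ (p + 1)^-1) * wcost p w a.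
Proof.
move=> L0; rewrite le_eqVlt => /predU1P[<- _ lip small|alpha0 alpha1 lip small].
  (* Here the robust bound holds for every [h > 0]. *)
  rewrite powR0 ?invr_eq0; last by rewrite gt_eqF//; move: p1; lra.
  rewrite expr0n/= mul0r in small.
  apply/ler_addgt0Pr => x x0.
  pose C := L `^ p * 3 `^ (p + 2) * wcost p w a.
  have C0 : 0 <= C by rewrite !mulr_ge0 ?powR_ge0// wcost_ge0.
  pose h := Num.min (1 / 10) (x / (C + 1)).
  have C1 : 0 < C + 1 by rewrite ltr_wpDl.
  have h0 : 0 < h by rewrite lt_min !divr_gt0.
  have := @wcost_robust d1 d2 a b e L h 0 L0 h0; rewrite ge_min lexx => /(_ isT (lexx _)).
  rewrite divr_ge0 ?powR_ge0// => /(_ isT lip small) H.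
  have hx : C * h <= x.
    apply: (@le_trans _ _ ((C + 1) * h)); first by rewrite ler_wpM2r ?(ltW h0)// lerDl.
    by rewrite mulrC -ler_pdivlMr// ge_min lexx orbT.
  by rewrite (le_trans H)//; move: hx; rewrite /C; lra.
have p0 : 0 < p + 1 by move: p1; lra.
apply: (@wcost_robust _ _ _ _ e _ _ (alpha ^+ 5 / 150)) => //.
- exact: powR_gt0.
- have -> : 1 / 10 = (10 `^ (p + 1))^-1 `^ (p + 1)^-1 :> R.
    by rewrite -powRN -powRrM mulNr divff ?gt_eqF// powR_inv1// div1r.
  apply: ge0_ler_powR; rewrite ?nnegrE ?invr_ge0 ?powR_ge0 ?(ltW p0) ?(ltW alpha0)//.
- by rewrite divr_ge0// exprn_ge0// ltW.
- rewrite -powRrM mulrCA mulVf ?gt_eqF// mulr1 (powR_mulrn 5)// ltW//.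
Qed.

(** Passes from [f] to [f'], then to [g'], then to [g]: two perturbations with the robust comparison
    between them. *)
Lemma wcost_compare {d1 d2} (f f' : I -> 'rV[R]_d1) (g g' : I -> 'rV[R]_d2)
    (e : rel I) (eps alpha : R) :
  0 < eps -> 0 <= alpha -> alpha <= (10 `^ (p + 1))^-1 ->
  (forall i j, ~~ e i j -> enorm (g' i - g' j) <= (1 + eps) * enorm (f' i - f' j)) ->
  (forall i, \sum_(j | e i j) w j <= alpha ^+ 5 / 150 * \sum_j w j) ->
  wcost p w g <= (1 + eps) `^ (p - 1) *
    ((1 + eps) `^ p * (1 + 3 `^ (p + 2) * alpha `^ (p + 1)^-1) *
     ((1 + eps) `^ (p - 1) * wcost p w f
      + ((1 + eps) / eps) `^ (p - 1) * \sum_i w i * enorm (f i - f' i) `^ p))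
    + ((1 + eps) / eps) `^ (p - 1) * \sum_i w i * enorm (g i - g' i) `^ p.
Proof.
move=> e0 alpha0 alpha1 lip small.
rewrite (le_trans (wcost_perturb eps g g' e0))// lerD2r ler_wpM2l ?powR_ge0//.
rewrite (le_trans (@wcost_robust_alpha _ _ f' g' e (1 + eps) alpha _ _ _ lip
    small))//; first by lra.
rewrite ler_wpM2l//; first by rewrite mulr_ge0 ?addr_ge0 ?mulr_ge0 ?powR_ge0.
apply: le_trans (wcost_perturb eps f' f e0) _.
rewrite lerD2l; apply: ler_wpM2l; first exact: powR_ge0.
by apply: ler_sum => i _; rewrite enormB.
Qed.

End WeightedCost.

(** * A fixed map *)

Lemma enorm_eq0 {R : realType} {d} (x : 'rV[R]_d) : enorm x = 0 -> x = 0.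
Proof.
move=> x0; have /eqP : sqnorm x = 0 by rewrite -sqr_enorm x0 expr0n.
rewrite psumr_eq0 => [/allP z|k _]; last exact: sqr_ge0.
apply/rowP => k; rewrite mxE; have := z k; rewrite mem_index_enum sqrf_eq0 => /(_ isT) /eqP.
by rewrite (_ : ord0 = 0).
Qed.

(** * Distorted pairs and excess stretching *)

Section Distortion.
Context {R : realType} {d m : nat}.
Variables (p eps : R) (F : 'rV[R]_d -> 'rV[R]_m).

Definition undistorted (x y : 'rV[R]_d) : bool :=
  (1 + eps)^-1 * enorm (x - y) <= enorm (F x - F y) <= (1 + eps) * enorm (x - y).

(** The integrand of the expectation condition on a dimension reduction, for one outcome. *)
Definition excess (x y : 'rV[R]_d) : R :=
  ((1 + eps) * enorm (x - y) < enorm (F x - F y))%R%:R *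
  (enorm (F x - F y) `^ p / enorm (x - y) `^ p - (1 + eps) `^ p).

Hypotheses (p1 : 1 <= p) (eps0 : 0 < eps).

Lemma undistortedC x y : undistorted x y = undistorted y x.
Proof. by rewrite /undistorted (enormB x) (enormB (F x)). Qed.

Lemma undistorted_xx x : undistorted x x.
Proof. by rewrite /undistorted !subrr !enorm0 !mulr0 lexx. Qed.

Lemma undistorted_up {x y} : undistorted x y ->
  enorm (F x - F y) <= (1 + eps) * enorm (x - y).
Proof. by case/andP. Qed.

Lemma undistorted_low {x y} : undistorted x y ->
  enorm (x - y) <= (1 + eps) * enorm (F x - F y).
Proof. by case/andP => + _; rewrite ler_pdivrMl//; move: eps0; lra. Qed.

Lemma excess_ge0 x y : 0 <= excess x y.
Proof.
rewrite /excess; have [lt|_] := ltP; last by rewrite mul0r.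
rewrite mul1r subr_ge0; have e1 : 0 <= 1 + eps by move: eps0; lra.
have [xy0|xy0] := eqVneq (enorm (x - y)) 0.
  have /enorm_eq0/eqP := xy0; rewrite subr_eq0 => /eqP xy.
  by move: lt; rewrite xy !subrr !enorm0 mulr0 ltxx.
have xy_gt0 : 0 < enorm (x - y) by rewrite lt0r xy0 enorm_ge0.
rewrite ler_pdivlMr ?powR_gt0// -powRM ?enorm_ge0//.
by apply: ge0_ler_powR; rewrite ?nnegrE ?mulr_ge0 ?enorm_ge0 ?(ltW lt)//; move: p1; lra.
Qed.

Lemma powR_excess x y : enorm (F x - F y) `^ p <=
  (1 + eps) `^ p * enorm (x - y) `^ p + excess x y * enorm (x - y) `^ p.
Proof.
rewrite /excess; have e1 : 0 <= 1 + eps by move: eps0; lra.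
have [lt|le] := ltP; last first.
  rewrite mul0r mul0r addr0 -powRM ?enorm_ge0//.
  by apply: ge0_ler_powR; rewrite ?nnegrE ?mulr_ge0 ?enorm_ge0//; move: p1; lra.
have [xy0|xy0] := eqVneq (enorm (x - y)) 0.
  have /enorm_eq0/eqP := xy0; rewrite subr_eq0 => /eqP xy.
  by move: lt; rewrite xy !subrr !enorm0 mulr0 ltxx.
have xy_gt0 : 0 < enorm (x - y) `^ p by rewrite powR_gt0// lt0r xy0 enorm_ge0.
by rewrite mul1r mulrBl divfK ?gt_eqF// subrKC.
Qed.

End Distortion.

(** * Moving the bad and the close points to their centers *)

Section FixedMap.
Context {R : realType} {I : finType} {d m n : nat}.
Variables (pt : I -> 'rV[R]_d) (cen : 'I_n -> 'rV[R]_d) (tau : I -> 'I_n).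
Variables (F : 'rV[R]_d -> 'rV[R]_m) (p eps alpha : R) (M w : I -> R).
Hypotheses (p1 : 1 <= p) (eps0 : 0 < eps) (alpha0 : 0 <= alpha).
Hypothesis alpha1 : alpha <= (10 `^ (p + 1))^-1.

Local Notation und := (undistorted eps F).

Definition displacement i : R := enorm (pt i - cen (tau i)) `^ p.
(** The mass [M i] dominates the cluster weight [w i] and does not depend on the solution. *)
Definition point_cost i : R := M i * displacement i.
Local Notation v := (\sum_i point_cost i).

(* The threshold is [alpha / 2] times the bound [alpha ^+ 5 / 150] that the
   robust extension puts on the fraction of bad partners of a point. *)
Definition bad_point i : bool :=
  (alpha ^+ 5 / 150 * (alpha / 2) * v <
     \sum_(j | ~~ und (pt i) (pt j)) point_cost j)
  || [exists k, ~~ und (pt i) (cen k)].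

(** The factor 2 counts moving costs before and after applying [F]; [alpha * v] is likewise twice
    the cost of moving the close points. The weights [w] do not occur. *)
Definition total_error : R :=
  \sum_i point_cost i *
    (2 * (bad_point i)%:R + excess p eps F (pt i) (cen (tau i))) + alpha * v.

Hypothesis cen_und : forall k l, und (cen k) (cen l).
Hypotheses (w_ge0 : forall i, 0 <= w i) (wM : forall i, w i <= M i).

Let W := \sum_i w i.
Let bv := alpha / 2 * v.
(** Closeness compares the displacement with [bv / W], cross-multiplied so that a cluster of zero
    weight is covered. *)
Let S i := (displacement i * W <= bv) || bad_point i.
(* Points that are bad, or so close to their center that their number cannot be
   controlled by their cost, are moved to their center. *)
Let pt' i := if S i then cen (tau i) else pt i.
Let e i j := [&& ~~ S i, ~~ S j & ~~ und (pt i) (pt j)].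

Let disp_ge0 i : 0 <= displacement i. Proof. exact: powR_ge0. Qed.
Let M_ge0 i : 0 <= M i. Proof. exact: le_trans (w_ge0 i) (wM i). Qed.
Lemma point_cost_ge0 i : 0 <= point_cost i. Proof. exact: mulr_ge0. Qed.
Let v_ge0 : 0 <= v. Proof. by apply: sumr_ge0 => i _; exact: point_cost_ge0. Qed.
Let bv_ge0 : 0 <= bv. Proof. by rewrite mulr_ge0// divr_ge0. Qed.
Let W_ge0 : 0 <= W. Proof. exact: sumr_ge0. Qed.
Let w_disp i : w i * displacement i <= point_cost i.
Proof. exact: ler_wpM2r. Qed.

Lemma not_bad_cen i k : ~~ bad_point i -> und (pt i) (cen k).
Proof.
by rewrite negb_or negb_exists => /andP[_ /forallP/(_ k)]; rewrite negbK.
Qed.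

Lemma moved_und i j : ~~ e i j -> und (pt' i) (pt' j).
Proof.
rewrite /e /pt'.
have [Si|/norP[_ bi]] := boolP (S i); have [Sj|/norP[_ bj]] := boolP (S j) => //=.
- by move=> _; rewrite undistortedC; exact: not_bad_cen.
- by move=> _; exact: not_bad_cen.
- by rewrite negbK.
Qed.

(** An unmoved [j] has [bv < displacement j * W], so [w j * bv] is at most [point_cost j * W]. As
    [i] is not bad, its distorted partners have total point cost at most [alpha ^ 5 / 150 * bv]. *)
Lemma moved_small i : \sum_(j | e i j) w j <= alpha ^+ 5 / 150 * W.
Proof.
have t0 : 0 <= alpha ^+ 5 / 150 by rewrite divr_ge0// exprn_ge0.
have [Si|nSi] := boolP (S i).
  by rewrite big_pred0 ?mulr_ge0// => j; rewrite /e Si.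
have : ~~ bad_point i by move: nSi => /norP[].
rewrite negb_or -leNgt => /andP[+ _]; rewrite -mulrA -/bv => vi.
have sub : \sum_(j | e i j) point_cost j <= alpha ^+ 5 / 150 * bv.
  rewrite (le_trans _ vi)// big_mkcond [leRHS]big_mkcond/=; apply: ler_sum => j _.
  by rewrite /e nSi/=; case: (und _ _) => /=; rewrite ?andbF ?andbT//;
      case: (S j) => //=; exact: point_cost_ge0.
have eW j : e i j -> bv < displacement j * W by case/and3P => _ /norP[+ _] _;
    rewrite -ltNge.
have [b0|bn0] := eqVneq bv 0; last first.
  have b_gt0 : 0 < bv by rewrite lt0r bn0.
  rewrite -(ler_pM2r b_gt0) mulrAC (le_trans _ (ler_wpM2r W_ge0 sub))// !mulr_suml.
  apply: ler_sum => j /eW lt.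
  apply: (@le_trans _ _ (w j * (displacement j * W))); first by rewrite ler_wpM2l// ltW.
  by rewrite mulrA ler_wpM2r.
(* With [bv = 0] the distorted partners have point cost 0 and positive displacement, hence weight
   0. *)
rewrite b0 mulr0 in sub; rewrite big1 ?mulr_ge0// => j eij.
have dj : 0 < displacement j.
  by have := eW j eij; rewrite b0 lt0r (lt0r (displacement j)) disp_ge0 andbT
      mulf_eq0 negb_or => /andP[/andP[-> _] _].
have vj : point_cost j <= 0.
  rewrite (le_trans _ sub)// (bigD1 j)//= lerDl sumr_ge0// => k _; exact: point_cost_ge0.
have := le_trans (w_disp j) vj; rewrite pmulr_lle0// => wj.
by apply/eqP; rewrite eq_le wj w_ge0.
Qed.

Let O := \sum_i w i * enorm (pt i - pt' i) `^ p.
Let O' := \sum_i w i * enorm (F (pt i) - F (pt' i)) `^ p.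
Let Exc := \sum_i point_cost i * excess p eps F (pt i) (cen (tau i)).

Let pp0 (x : R) : x = 0 -> x `^ p = 0.
Proof. by move=> ->; rewrite powR0// gt_eqF//; move: p1; lra. Qed.

(** Close points pay at most [w i * (bv / W)] each, in total [bv]; a bad point pays at most its
    point cost. *)
Lemma moved_cost_le : O <= bv + \sum_i point_cost i * (bad_point i)%:R.
Proof.
apply: (@le_trans _ _ (\sum_i (w i * (bv / W) + point_cost i * (bad_point i)%:R)));
    last first.
  rewrite big_split/= lerD2r -mulr_suml -/W.
  by have [->|W0] := eqVneq W 0; [rewrite mul0r|rewrite mulrC divfK].
apply: ler_sum => i _; rewrite /pt'.
have pb0 : 0 <= point_cost i * (bad_point i)%:R by rewrite mulr_ge0// point_cost_ge0.
have wb0 : 0 <= w i * (bv / W) by rewrite mulr_ge0// divr_ge0.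
have [Si|_] := boolP (S i); last by rewrite subrr enorm0 pp0// mulr0 addr_ge0.
rewrite -/(displacement i); case: (boolP (bad_point i)) => bi.
  by rewrite mulr1 -[leLHS]add0r lerD.
move: Si; rewrite /S (negPf bi) orbF mulr0 addr0 => dW.
have [W0|Wn0] := eqVneq W 0.
  have /eqP := W0; rewrite psumr_eq0// => /allP/(_ i).
  by rewrite mem_index_enum => /(_ isT)/eqP->; rewrite !mul0r.
by rewrite ler_wpM2l// ler_pdivlMr// lt0r Wn0.
Qed.

Lemma moved_image_cost_le : O' <= (1 + eps) `^ p * O + Exc.
Proof.
rewrite /O /Exc mulr_sumr -big_split/=; apply: ler_sum => i _; rewrite /pt'.
have ex0 := excess_ge0 p eps F p1 eps0 (pt i) (cen (tau i)).
have [Si|_] := boolP (S i); last first.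
  by rewrite !subrr !enorm0 pp0// !mulr0 add0r mulr_ge0// point_cost_ge0.
rewrite (le_trans (ler_wpM2l (w_ge0 i) (powR_excess p eps F p1 eps0 _ _)))//.
rewrite mulrDr mulrCA lerD2l mulrCA mulrC ler_wpM2r//.
Qed.

Lemma moved_error_le : 2 * O + Exc <= total_error.
Proof.
have := moved_cost_le; rewrite /total_error /Exc => H.
have -> : \sum_i point_cost i * (2 * (bad_point i)%:R + excess p eps F (pt i) (cen
    (tau i))) =
    2 * (\sum_i point_cost i * (bad_point i)%:R) + Exc.
  by rewrite /Exc mulr_sumr -big_split/=; apply: eq_bigr => i _; ring.
rewrite /Exc; move: H; rewrite /bv; lra.
Qed.

Let B := 1 + 3 `^ (p + 2) * alpha `^ (p + 1)^-1.

(** Shared by both directions, with [c1] and [c2] the moving costs on the two sides. All powers of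
    [1 + eps] are at least 1, so both costs can take the common factor, whose exponent is
    [(p - 1) + p + (p - 1)]. *)
Let error_algebra (x y k c1 c2 : R) :
  0 <= k -> 0 <= c2 -> c1 + c2 <= O + ((1 + eps) `^ p * O + Exc) ->
  y <= (1 + eps) `^ (p - 1) *
       ((1 + eps) `^ p * B * ((1 + eps) `^ (p - 1) * x + (1 + eps) `^ (p - 1) * k * c1))
       + (1 + eps) `^ (p - 1) * k * c2 ->
  y <= (1 + eps) `^ (3 * p - 2) * B * (x + (1 + eps) `^ p * total_error * k).
Proof.
have e1 : 1 <= 1 + eps by move: eps0; lra.
have -> : (1 + eps) `^ (3 * p - 2) = (1 + eps) `^ (p - 1) * (1 + eps) `^ p * (1 +
    eps) `^ (p - 1).
  have e0 : 1 + eps != 0 by rewrite gt_eqF//; move: eps0; lra.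
  by rewrite -!powRD ?e0 ?implybT//; congr (_ `^ _); ring.
have Q1 : 1 <= (1 + eps) `^ (p - 1) by rewrite -[leLHS](powRr0 (1 + eps)) ler_powR//;
    move: p1; lra.
have Q2 : 1 <= (1 + eps) `^ p by rewrite -[leLHS](powRr0 (1 + eps)) ler_powR//;
    move: p1; lra.
have B1 : 1 <= B by rewrite /B lerDl mulr_ge0// powR_ge0.
have O0 : 0 <= O by exact: wcost_sum_ge0.
have Exc0 : 0 <= Exc.
  by apply: sumr_ge0 => i _; rewrite mulr_ge0 ?point_cost_ge0 ?excess_ge0.
have Z := moved_error_le.
move: B1 O0 Exc0 Z Q1 Q2; move: ((1 + eps) `^ (p - 1)) ((1 + eps) `^ p) => q Q.
move: B O Exc total_error => b o ex z b1 o0 ex0 oz q1 Q1 k0 c20 c12 yle.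
rewrite (le_trans yle)//.
have N1 : 1 <= q * Q * b by rewrite -[1]mulr1 ler_pM// -[1]mulr1 ler_pM.
have H : q * Q * b * c1 + c2 <= q * Q * b * (Q * z).
  apply: (@le_trans _ _ (q * Q * b * (c1 + c2))).
    by rewrite mulrDr lerD2l -[leLHS]mul1r ler_wpM2r.
  rewrite ler_wpM2l//; first by rewrite (le_trans _ N1).
  have H1 : Q * (2 * o + ex) <= Q * z by rewrite ler_wpM2l// (le_trans _ Q1).
  have H2 := ler_wpM2r o0 Q1; have H3 := ler_wpM2r ex0 Q1; lra.
have qk : 0 <= q * k by rewrite mulr_ge0// (le_trans _ q1).
have := ler_wpM2l qk H; lra.
Qed.

Lemma wcost_distortion :
  wcost p w (F \o pt) <= (1 + eps) `^ (3 * p - 2) * B *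
    (wcost p w pt + (1 + eps) `^ p * total_error * (eps `^ (p - 1))^-1) /\
  wcost p w pt <= (1 + eps) `^ (3 * p - 2) * B *
    (wcost p w (F \o pt) + (1 + eps) `^ p * total_error * (eps `^ (p - 1))^-1).
Proof.
have O0 : 0 <= O by exact: wcost_sum_ge0.
have O'0 : 0 <= O' by exact: wcost_sum_ge0.
have k0 : 0 <= (eps `^ (p - 1))^-1 by rewrite invr_ge0 powR_ge0.
have e1 : 0 <= 1 + eps by move: eps0; lra.
have kE : ((1 + eps) / eps) `^ (p - 1) = (1 + eps) `^ (p - 1) * (eps `^ (p - 1))^-1.
  rewrite powRM ?invr_ge0 ?(ltW eps0)//; congr (_ * _).
  by rewrite -powR_inv1 ?(ltW eps0)// powRAC powR_inv1// powR_ge0.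
have sumle : O + O' <= O + ((1 + eps) `^ p * O + Exc) by rewrite lerD2l moved_image_cost_le.
split.
  apply: (error_algebra _ _ _ _ _ k0 O'0 sumle); rewrite -kE.
  apply: (wcost_compare p w p1 w_ge0 pt pt' (F \o pt) (F \o pt') e) => //.
  - by move=> i j nij; exact: undistorted_up (moved_und _ _ nij).
  - exact: moved_small.
rewrite addrC in sumle.
apply: (error_algebra _ _ _ _ _ k0 O0 sumle); rewrite -kE.
apply: (wcost_compare p w p1 w_ge0 (F \o pt) (F \o pt') pt pt' e) => //.
- by move=> i j nij; exact: (undistorted_low eps F eps0 (moved_und _ _ nij)).
- exact: moved_small.
Qed.

End FixedMap.

(** * Solutions of the barycenter problem *)

Section Solutions.
Context {R : realType} {d k n : nat}.
Variables (p : R) (mu : 'I_k -> {fsfun 'rV[R]_d -> R with 0}).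

Lemma coupling_le (m1 m2 : {fsfun 'rV[R]_d -> R with 0}) g z :
  coupling m1 m2 g -> g z <= m1 z.1.
Proof.
move=> [g0 g1 _]; rewrite -g1.
have [zg|zg] := boolP (z \in finsupp g); last first.
  by rewrite fsfun_dflt// sumr_ge0.
by rewrite big_mkcond (bigD1_seq z) ?fset_uniq//= eqxx lerDl sumr_ge0// => i _; case: ifP.
Qed.

Lemma coupling_gt0 (m1 m2 : {fsfun 'rV[R]_d -> R with 0}) g z :
  coupling m1 m2 g -> z \in finsupp g -> z.2 \in finsupp m2.
Proof.
move=> [g0 _ g2] zg; rewrite mem_finsupp -g2 gt_eqF//.
have gz : 0 < g z by rewrite lt0r g0 andbT -mem_finsupp.
rewrite big_mkcond (bigD1_seq z) ?fset_uniq//= eqxx ltr_pwDl// sumr_ge0// => i _;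
    by case: ifP.
Qed.

(** A coupling sends mass only to support points of its second marginal, and [c] lists them all. *)
Lemma coupling_mass (m1 m2 : {fsfun 'rV[R]_d -> R with 0}) g
    (c : 'I_n -> 'rV[R]_d) x :
  coupling m1 m2 g -> (forall y, y \in finsupp m2 -> exists j, c j = y) ->
  m1 x <= \sum_(j < n) g (x, c j).
Proof.
move=> cg sup; have [g0 g1 _] := cg; rewrite -g1.
apply: (@le_trans _ _ (\sum_(z <- finsupp g | z.1 == x) \sum_(j < n) (if c j == z.2
    then g z else 0))).
  rewrite big_seq_cond [leRHS]big_seq_cond; apply: ler_sum => z /andP[zg _].
  have [j cj] := sup _ (coupling_gt0 _ _ _ _ cg zg).
  by rewrite (bigD1 j)//= cj eqxx lerDl sumr_ge0// => i _; case: ifP.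
rewrite exchange_big/=; apply: ler_sum => j _.
have [zg|zg] := boolP ((x, c j) \in finsupp g).
  rewrite big_mkcond (bigD1_seq (x, c j)) ?fset_uniq//= !eqxx big1 ?addr0// => -[y1
      y2] /= yn.
  by case: ifP => // /eqP yx; case: ifP => // /eqP cy; move: yn; rewrite yx cy eqxx.
rewrite big_seq_cond big1// => -[y1 y2] /= /andP[yg /eqP yx].
by case: eqP => // cy; move: zg; rewrite -yx cy yg.
Qed.

(** Points outside the cluster have weight zero, so the sum may run over all points. *)
Lemma cluster_costE {m} (f : 'rV[R]_d -> 'rV[R]_m) (wj : 'rV[R]_d -> R) :
  (forall x, 0 <= wj x) ->
  cluster_cost p mu f wj =
  wcost p (fun i : all_points mu => wj (val i)) (f \o val).
Proof.
move=> w0; rewrite /cluster_cost /wcost.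
suff E : forall c : 'rV[R]_m, \sum_(x <- cluster mu wj) wj x * enorm (f x - c) `^ p =
    \sum_(i : all_points mu) wj (val i) * enorm ((f \o val) i - c) `^ p.
  by congr inf; congr image; apply/funext.
move=> c.
rewrite /cluster big_fset/= big_mkcond/= big_seq_fsetE/=; apply: eq_bigr => i _.
by case: ltP => // wi; rewrite (@le_anti _ _ (wj (fsval i)) 0) ?wi ?w0// mul0r.
Qed.

Definition mass (x : 'rV[R]_d) : R := \sum_(i < k) mu i x.

Lemma solution_ge0 (w : 'I_n -> 'rV[R]_d -> R) j x : solution p mu w -> 0 <= w j x.
Proof.
move=> [nu [c [_ _ [g [hg hw]]]]]; rewrite hw sumr_ge0// => i _.
by have [[]] := hg i.
Qed.

Lemma solution_le_mass (w : 'I_n -> 'rV[R]_d -> R) j x : solution p mu w -> w j x <= mass x.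
Proof.
move=> [nu [c [_ _ [g [hg hw]]]]]; rewrite hw; apply: ler_sum => i _.
by have [cg _] := hg i; exact: (coupling_le _ _ _ (x, c j) cg).
Qed.

(** All mass of a point is sent to centers, each at least as far as the nearest one. *)
Lemma nearest_cost_le (nu : {fsfun 'rV[R]_d -> R with 0}) (c : 'I_n -> 'rV[R]_d) w
    (tau : all_points mu -> 'I_n) : 0 <= p ->
  solution_to p mu nu c w ->
  (forall i j, enorm (val i - c (tau i)) <= enorm (val i - c j)) ->
  \sum_i point_cost val c tau p (fun i => mass (val i)) i <= solution_cost p mu c w.
Proof.
move=> p0 [_ [_ sup] [g [hg hw]]] near.
rewrite /solution_cost exchange_big/= big_seq_fsetE/=; apply: ler_sum => i _.
apply: (@le_trans _ _ (\sum_(j < n) w j (val i) * displacement val c tau p i)).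
  rewrite -mulr_suml ler_wpM2r ?powR_ge0//.
  under eq_bigr do rewrite hw.
  rewrite exchange_big/=; apply: ler_sum => l _.
  by have [cg _] := hg l; exact: coupling_mass cg sup.
apply: ler_sum => j _; apply: ler_wpM2l.
  by rewrite hw; apply: sumr_ge0 => l _; have [[]] := hg l.
by apply: ge0_ler_powR; rewrite ?nnegrE ?enorm_ge0.
Qed.

End Solutions.

Lemma exists_nearest {R : realType} {I : finType} {d n} (pt : I -> 'rV[R]_d)
    (c : 'I_n -> 'rV[R]_d) : 'I_n ->
  exists tau : I -> 'I_n, forall i j, enorm (pt i - c (tau i)) <= enorm (pt i - c j).
Proof.
move=> j0; exists (fun i => [arg min_(j < j0) enorm (pt i - c j)]%O) => i j.
by case: arg_minP => // l _; apply.
Qed.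

(** * The random map *)

Section Probability.
Context {R : realType} {dT : measure_display} {T : measurableType dT}.
Variable P : probability T R.

Lemma measurable_gt (Z : T -> R) (a : R) : measurable_fun setT Z ->
  measurable [set t | a < Z t].
Proof.
move=> mZ; rewrite -[X in measurable X]setTI.
rewrite (_ : [set t | a < Z t] = Z @^-1` `]a, +oo[); last first.
  by apply/seteqP; split => t /=; rewrite in_itv/= andbT.
exact: mZ.
Qed.

(** The strict inequality lets the bound cover [K = 0], where [Z] vanishes almost everywhere. *)
Lemma markov_gt (Z : T -> R) (K eta : R) : measurable_fun setT Z ->
  (forall t, 0 <= Z t) -> 0 < eta -> 0 <= K ->
  (\int[P]_t (Z t)%:E <= K%:E)%E -> (P [set t | (K / eta < Z t)%R] <= eta%:E)%E.
Proof.
move=> mZ Z0 eta0; rewrite le_eqVlt => /predU1P[<- IZ|K0 IZ].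
  suff -> : P [set t | (0 / eta < Z t)%R] = 0%E by rewrite lee_fin ltW.
  rewrite mul0r.
  have I0 : (\int[P]_t `|(Z t)%:E| = 0)%E.
    under eq_integral do rewrite gee0_abs ?lee_fin//.
    by apply/eqP; rewrite eq_le IZ/= integral_ge0// => t _; rewrite lee_fin.
  have [N [mN PN sub]] := (@ae_eq_integral_abs _ T R P setT measurableT
    (fun t => (Z t)%:E) ((measurable_EFinP _ _).2 mZ)).1 I0.
  apply/eqP; rewrite eq_le measure_ge0 andbT -PN le_measure ?inE//.
    exact: measurable_gt.
  move=> t /= Zt; apply: sub => /= /(_ I)[Zt0].
  by move: Zt; rewrite Zt0 ltxx.
have a0 : 0 < K / eta by rewrite divr_gt0.
have : ((K / eta)%R%:E * P [set t | (K / eta < Z t)%R] <= K%:E)%E.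
  rewrite -integral_cst//; last exact: measurable_gt.
  apply: le_trans IZ.
  apply: (@le_trans _ _ (\int[P]_(t in [set t | (K / eta < Z t)%R]) (Z t)%:E)%E).
    apply: ge0_le_integral => //.
    - exact: measurable_gt.
    - by move=> t _; rewrite lee_fin ltW.
    - apply: measurable_funTS; exact/measurable_EFinP.
    - by move=> t /= Zt; rewrite lee_fin ltW.
  apply: ge0_subset_integral => //.
  - exact: measurable_gt.
  - exact/measurable_EFinP.
  - by move=> t _; rewrite lee_fin.
have Pf : P [set t | (K / eta < Z t)%R] \is a fin_num.
  by apply: fin_num_measure; exact: measurable_gt.
rewrite -(fineK Pf) -EFinM !lee_fin => H.
rewrite -(ler_pM2l a0) (le_trans H)// divfK// gt_eqF//.
Qed.

Lemma integral_weighted_sum_le (I : finType) (v : I -> R) (h : I -> T -> R) (K : R) :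
  (forall i, 0 <= v i) -> (forall i t, 0 <= h i t) ->
  (forall i, measurable_fun setT (h i)) ->
  (forall i, (\int[P]_t (h i t)%:E <= K%:E)%E) ->
  (\int[P]_t (\sum_i v i * h i t)%R%:E <= ((\sum_i v i) * K)%R%:E)%E.
Proof.
move=> v0 h0 mh hK.
under eq_integral do rewrite -sumEFin.
rewrite ge0_integral_sum//; last 2 first.
- by move=> i; apply/measurable_EFinP; exact: measurable_funM.
- by move=> i t _; rewrite lee_fin mulr_ge0.
rewrite mulr_suml -sumEFin; apply: lee_sum => i _.
under eq_integral do rewrite EFinM.
rewrite ge0_integralZl_EFin//; last 2 first.
- by move=> t _; rewrite lee_fin.
- exact/measurable_EFinP.
by rewrite EFinM lee_wpmul2l// lee_fin.
Qed.

Lemma union_bound (J : finType) (Q : pred J) (D : J -> set T) (delta : R) :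
  (forall x, measurable (D x)) -> (forall x, Q x -> (P (D x) <= delta%:E)%E) ->
  measurable [set t | exists x, Q x /\ D x t] /\
  (P [set t | exists x, Q x /\ D x t] <= (#|Q|%:R * delta)%R%:E)%E.
Proof.
move=> mD PD.
have -> : [set t | exists x, Q x /\ D x t] = \big[setU/set0]_(x <- enum Q) D x.
  apply/seteqP; split => t /=.
    by move=> [x [Qx Dx]]; rewrite -bigcup_seq; exists x => //=; rewrite mem_enum.
  by rewrite -bigcup_seq => -[x /=]; rewrite mem_enum => Qx Dx; exists x.
have mU s : measurable (\big[setU/set0]_(x <- s) D x) by apply: bigsetU_measurable.
split; first exact: mU.
rewrite cardE; have : forall x, x \in enum Q -> Q x by move=> x; rewrite mem_enum.
elim: (enum Q) => [_|x s IH sQ]; first by rewrite big_nil measure0 mul0r.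
rewrite big_cons/= -natr1 mulrDl mul1r addrC EFinD.
apply: le_trans (measureU2 _ _ _) _ => //.
apply: leeD; first by apply: PD; rewrite sQ// mem_head.
by apply: IH => y ys; rewrite sQ// in_cons ys orbT.
Qed.

Lemma measurable_bool_natr (b : T -> bool) : measurable [set t | b t] ->
  measurable_fun setT (fun t => (b t)%:R : R).
Proof.
move=> mb; rewrite (_ : (fun _ => _) = \1_[set t | b t]); first exact: measurable_indic.
by apply/funext => t; rewrite indicE; congr (nat_of_bool _)%:R; apply/idP/idP; rewrite inE.
Qed.

Lemma integral_bool_natr (b : T -> bool) : measurable [set t | b t] ->
  (\int[P]_t ((b t)%:R : R)%:E = P [set t | b t])%E.
Proof.
move=> mb; rewrite -[in RHS](setIT [set t | b t]).
rewrite -integral_indic//; apply: eq_integral => t _.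
by rewrite indicE; congr (nat_of_bool _)%:R%:E; apply/idP/idP; rewrite inE.
Qed.

End Probability.

(** * Expected error of a random dimension reduction *)

Section RandomReduction.
Context {R : realType} {dT : measure_display} {T : measurableType dT}.
Variables (P : probability T R) (d m : nat) (p eps delta alpha : R).
Variable pi : T -> 'rV[R]_d -> 'rV[R]_m.
Hypotheses (p1 : 1 <= p) (eps0 : 0 < eps).
Hypothesis hpi : dimension_reduction P p eps delta alpha pi.

Lemma measurable_enorm_image x y :
  measurable_fun setT (fun t => enorm (pi t x - pi t y)).
Proof.
rewrite (_ : (fun t => _) = Num.sqrt \o
    (fun t => \sum_(i < m) (pi t x ord0 i - pi t y ord0 i) ^+ 2)); last first.
  by apply/funext => t; congr Num.sqrt; apply: eq_bigr => i _; rewrite !mxE.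
apply: measurableT_comp.
  by apply: continuous_measurable_fun; exact: sqrt_continuous.
apply: measurable_sum => i; apply: measurable_funX.
by apply: measurable_funB; exact: hpi.1.
Qed.

Lemma measurable_undistorted x y : measurable [set t | undistorted eps (pi t) x y].
Proof.
rewrite -[X in measurable X]setTI.
rewrite (_ : [set t | _] = (fun t => enorm (pi t x - pi t y)) @^-1`
    `[(1 + eps)^-1 * enorm (x - y), (1 + eps) * enorm (x - y)]); last first.
  by apply/seteqP; split => t /=; rewrite in_itv.
exact: measurable_enorm_image.
Qed.

Lemma measurable_distorted x y : measurable [set t | ~~ undistorted eps (pi t) x y].
Proof.
rewrite (_ : [set t | _] = ~` [set t | undistorted eps (pi t) x y]).
  by apply: measurableC; exact: measurable_undistorted.
by apply/seteqP; split => t /= /negP.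
Qed.

Lemma distorted_le x y : (P [set t | ~~ undistorted eps (pi t) x y] <= delta%:E)%E.
Proof.
rewrite (_ : [set t | _] = ~` [set t | undistorted eps (pi t) x y]); last first.
  by apply/seteqP; split => t /= /negP.
rewrite probability_setC; last exact: measurable_undistorted.
have [+ _] := hpi.2 x y.
rewrite (_ : [set t | _] = [set t | undistorted eps (pi t) x y])//.
have Pf : P [set t | undistorted eps (pi t) x y] \is a fin_num.
  by apply: fin_num_measure; exact: measurable_undistorted.
by rewrite -(fineK Pf) -EFinB !lee_fin; lra.
Qed.

Lemma measurable_excess x y : measurable_fun setT (fun t => excess p eps (pi t) x y).
Proof.
apply: measurable_funM.
  apply: measurable_bool_natr; apply: measurable_gt; exact: measurable_enorm_image.
apply: measurable_funB => //; apply: measurable_funM => //.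
apply: (measurableT_comp (measurable_powR p)); exact: measurable_enorm_image.
Qed.

Lemma integral_excess_le x y : (\int[P]_t (excess p eps (pi t) x y)%:E <= alpha%:E)%E.
Proof.
have [_] := hpi.2 x y; rewrite unlock; apply: le_trans.
rewrite le_eqVlt; apply/orP; left; apply/eqP; apply: eq_integral => t _.
congr EFin; rewrite /excess indicE; congr (_ * _).
by congr (nat_of_bool _)%:R; apply/idP/idP; rewrite inE.
Qed.

(** [alpha] bounds the expectation of a nonnegative excess. *)
Lemma reduction_alpha_ge0 : 0 <= alpha.
Proof.
have := integral_excess_le 0 0; rewrite -lee_fin; apply: le_trans.
by apply: integral_ge0 => t _; rewrite lee_fin excess_ge0.
Qed.

Section ExpectedError.
Context {I : finType} {n : nat}.
Variables (pt : I -> 'rV[R]_d) (cen : 'I_n -> 'rV[R]_d) (tau : I -> 'I_n).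
Variable M : I -> R.
Hypotheses (M_ge0 : forall i, 0 <= M i) (n0 : (0 < n)%N).
Hypothesis hdelta : delta <= Num.min (alpha ^+ 7 / 600) (alpha / n%:R).

Local Notation v := (point_cost pt cen tau p M).
Local Notation bad t i := (bad_point pt cen tau (pi t) p eps alpha M i).

Let v_ge0 i : 0 <= v i. Proof. by rewrite mulr_ge0// powR_ge0. Qed.
Let vs_ge0 : 0 <= \sum_i v i. Proof. exact: sumr_ge0. Qed.

Let distorted_mass i t := \sum_j v j * (~~ undistorted eps (pi t) (pt i) (pt j))%:R.

Let measurable_distorted_mass i : measurable_fun setT (distorted_mass i).
Proof.
apply: measurable_sum => j; apply: measurable_funM => //.
by apply: measurable_bool_natr; exact: measurable_distorted.
Qed.

Let alpha0 := reduction_alpha_ge0.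

(** The expected distorted mass is at most [delta] times the total, and Markov's inequality at level
    [alpha / 2] turns [alpha ^ 7 / 600] into [alpha ^ 5 / 150 * (alpha / 2)]. *)
Let heavy_le i :
  (P [set t | (alpha ^+ 5 / 150 * (alpha / 2) * (\sum_j v j) < distorted_mass i t)%R]
   <= (alpha / 2)%:E)%E.
Proof.
have [hd1 _] : delta <= alpha ^+ 7 / 600 /\ delta <= alpha / n%:R.
  by move: hdelta; rewrite le_min => /andP.
have mass0 t : 0 <= distorted_mass i t.
  by apply: sumr_ge0 => j _; rewrite mulr_ge0.
have K0 : 0 <= (\sum_j v j) * (alpha ^+ 7 / 600).
  apply: mulr_ge0; first exact: vs_ge0.
  by apply: divr_ge0; [exact: exprn_ge0|exact: ler0n].
have IK : (\int[P]_t (distorted_mass i t)%:E <= ((\sum_j v j) * (alpha ^+ 7 / 600))%:E)%E.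
  apply: integral_weighted_sum_le => // j.
    by apply: measurable_bool_natr; exact: measurable_distorted.
  rewrite integral_bool_natr; last exact: measurable_distorted.
  by rewrite (le_trans (distorted_le _ _))// lee_fin.
have H eta : 0 < eta -> (P [set t | ((\sum_j v j) * (alpha ^+ 7 / 600) / eta <
    distorted_mass i t)%R] <= eta%:E)%E.
  by move=> eta0; exact: markov_gt.
have [az|an0] := eqVneq alpha 0; last first.
  have a0 : 0 < alpha by rewrite lt0r an0.
  have := H (alpha / 2) ltac:(lra).
  rewrite (_ : _ * _ / (alpha / 2) = alpha ^+ 5 / 150 * (alpha / 2) * (\sum_j v j))//.
  by field; rewrite gt_eqF.
(* Markov's inequality with a zero mean holds for every [x > 0]. *)
rewrite az !expr0n/= !(mul0r, mulr0); apply/lee_addgt0Pr => x x0; rewrite add0e.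
by have := H x x0; rewrite az expr0n/= !(mul0r, mulr0).
Qed.

Let bad_set i : [set t | bad t i] =
  [set t | (alpha ^+ 5 / 150 * (alpha / 2) * (\sum_j v j) < distorted_mass i t)%R] `|`
  [set t | exists k, predT k /\ [set t | ~~ undistorted eps (pi t) (pt i) (cen k)] t].
Proof.
have E t : distorted_mass i t = \sum_(j | ~~ undistorted eps (pi t) (pt i) (pt j)) v j.
  rewrite [RHS]big_mkcond/=; apply: eq_bigr => j _.
  by case: (undistorted _ _ _ _); rewrite /= ?mulr0 ?mulr1.
apply/seteqP; split => t /=.
  case/orP => [lt|/existsP[k nk]]; first by left; rewrite E.
  by right; exists k.
rewrite /bad_point -E; case=> [->//|[k [_ nk]]].
by apply/orP; right; apply/existsP; exists k.
Qed.

Let far_union i := @union_bound R dT T P 'I_n predT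
  (fun k => [set t | ~~ undistorted eps (pi t) (pt i) (cen k)]) delta
  (fun k => measurable_distorted (pt i) (cen k)) (fun k _ => distorted_le (pt i) (cen k)).

Lemma measurable_bad i : measurable [set t | bad t i].
Proof.
rewrite bad_set; apply: measurableU; last exact: (far_union i).1.
exact: measurable_gt.
Qed.

(** [alpha / 2] for heavy distorted mass, plus [n * delta <= alpha] for the centers. *)
Lemma bad_le i : (P [set t | bad t i] <= (3 / 2 * alpha)%:E)%E.
Proof.
have [_ hd2] : delta <= alpha ^+ 7 / 600 /\ delta <= alpha / n%:R.
  by move: hdelta; rewrite le_min => /andP.
rewrite bad_set; apply: le_trans (measureU2 _ _ _) _.
- exact: measurable_gt.
- exact: (far_union i).1.
have -> : 3 / 2 * alpha = alpha / 2 + alpha by lra.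
rewrite EFinD; apply: leeD; first exact: heavy_le.
apply: le_trans (far_union i).2 _.
rewrite lee_fin cardT size_enum_ord mulrC -ler_pdivlMr// ltr0n//.
Qed.

Lemma total_errorE t : total_error pt cen tau (pi t) p eps alpha M =
  \sum_i v i * (2 * (bad t i)%:R + excess p eps (pi t) (pt i) (cen (tau i)) + alpha).
Proof.
rewrite /total_error mulr_sumr -big_split/=; apply: eq_bigr => i _.
by ring.
Qed.

Lemma measurable_total_error :
  measurable_fun setT (fun t => total_error pt cen tau (pi t) p eps alpha M).
Proof.
rewrite (funext total_errorE).
apply: measurable_sum => i; apply: measurable_funM => //.
apply: measurable_funD => //; apply: measurable_funD; last exact: measurable_excess.
by apply: measurable_funM => //; apply: measurable_bool_natr; exact: measurable_bad.
Qed.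

Let error_ge0 t i : 0 <= 2 * (bad t i)%:R + excess p eps (pi t) (pt i) (cen (tau i)).
Proof. by apply: addr_ge0; [exact: mulr_ge0|exact: excess_ge0]. Qed.

Lemma total_error_ge0 t : 0 <= total_error pt cen tau (pi t) p eps alpha M.
Proof.
rewrite total_errorE; apply: sumr_ge0 => i _; by rewrite mulr_ge0// addr_ge0.
Qed.

(** Each point contributes twice [3 / 2 * alpha] for being bad, [alpha] for excess and the constant
    [alpha]. *)
Lemma integral_total_error_le :
  (\int[P]_t (total_error pt cen tau (pi t) p eps alpha M)%:E
   <= ((\sum_i v i) * (5 * alpha))%:E)%E.
Proof.
under eq_integral do rewrite total_errorE.
apply: integral_weighted_sum_le => //.
- by move=> i t; rewrite addr_ge0.
- move=> i; apply: measurable_funD => //; apply: measurable_funD;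
      last exact: measurable_excess.
  by apply: measurable_funM => //; apply: measurable_bool_natr; exact: measurable_bad.
move=> i.
have mb : measurable_fun setT (fun t => (bad t i)%:R : R).
  by apply: measurable_bool_natr; exact: measurable_bad.
under eq_integral do rewrite EFinD EFinD EFinM.
have me := measurable_excess (pt i) (cen (tau i)).
rewrite ge0_integralD//; last 2 first.
- by move=> t _; rewrite -EFinM -EFinD lee_fin.
- apply: emeasurable_funD; last exact/measurable_EFinP.
  by apply/measurable_EFinP; exact: measurable_funM.
rewrite ge0_integralD//; last 3 first.
- by apply/measurable_EFinP; exact: measurable_funM.
- by move=> t _; rewrite lee_fin excess_ge0.
- exact/measurable_EFinP.
rewrite ge0_integralZl_EFin//; last first.
- exact/measurable_EFinP.
rewrite integral_bool_natr; last exact: measurable_bad.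
rewrite integral_cst//.
have -> : 5 * alpha = 2 * (3 / 2 * alpha) + alpha + alpha by lra.
rewrite !EFinD; apply: leeD; last first.
  by rewrite -[leRHS]mule1; apply: lee_wpmul2l; [rewrite lee_fin|exact: probability_le1].
apply: leeD; last exact: integral_excess_le.
by rewrite EFinM; apply: lee_wpmul2l; [rewrite lee_fin|exact: bad_le].
Qed.

End ExpectedError.
End RandomReduction.

(** * The event of high probability *)

Lemma card_ltn_pairs n : #|[pred x : 'I_n * 'I_n | (x.1 < x.2)%N]| = 'C(n, 2).
Proof.
rewrite -sum1_card -(pair_big_dep xpredT (fun i j : 'I_n => (i < j)%N) (fun _ _ => 1%N))/=.
rewrite (exchange_big_dep xpredT)//= -bin2_sum big_mkord; apply: eq_bigr => i _.
by rewrite -(big_ord_widen n (fun=> 1%N) (ltnW (ltn_ord i))) sum1_card card_ord.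
Qed.

Theorem theorem16 (R : realType) (c c' : R) (hc : 0 < c) (hc' : 0 < c')
    (p eps eta alpha delta : R) (k n d m : nat)
    (hp : 1 <= p) (heps : 0 < eps) (heta : 0 < eta)
    (halpha : alpha <= (10 `^ (p + 1))^-1)
    (hdelta : delta <= Num.min (alpha ^+ 7 / 600) (alpha / n%:R))
    (hk : (0 < k)%N)
    (mu : 'I_k -> {fsfun 'rV[R]_d -> R with 0})
    (hmu : forall i, is_distribution (mu i))
    (dT : measure_display) (T : measurableType dT) (P : probability T R)
    (pi : T -> 'rV[R]_d -> 'rV[R]_m)
    (hpi : standard_dimension_reduction P c c' p eps delta alpha pi)
    (nustar : {fsfun 'rV[R]_d -> R with 0}) (cstar : 'I_n -> 'rV[R]_d)
    (wstar : 'I_n -> 'rV[R]_d -> R)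
    (hnustar : optimal_barycenter p n mu nustar)
    (hwstar : solution_to p mu nustar cstar wstar)
    (w : T -> 'I_n -> 'rV[R]_d -> R) (hw : random_solution p mu w)
    (j : 'I_n) :
  let A := (1 + eps) `^ (3 * p - 2) *
           (1 + 3 `^ (p + 2) * alpha `^ (p + 1)^-1) in
  let cea := 5 * (1 + eps) `^ p * alpha / (eta * eps `^ (p - 1)) in
  let coststar := solution_cost p mu cstar wstar in
  exists G : set T,
    [/\ measurable G,
        ((1 - eta - 'C(n, 2)%:R * delta)%:E <= P G)%E
      & forall t, G t ->
          let costC := cluster_cost p mu id (w t j) in
          let costpiC := cluster_cost p mu (pi t) (w t j) in
          costpiC <= A * (costC + cea * coststar) /\
          costC <= A * (costpiC + cea * coststar)].

Proof.
move=> A cea coststar.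
have [hdr _] := hpi.
have alpha0 : 0 <= alpha by exact: (reduction_alpha_ge0 _ _ _ _ _ _ _ _ hp heps hdr).
have n0 : (0 < n)%N by exact: leq_ltn_trans (leq0n j) (ltn_ord j).
pose X := all_points mu.
pose pt (i : X) : 'rV[R]_d := val i.
have [tau near] := exists_nearest pt cstar j.
(* The total mass dominates the weights of every solution, so the error is defined independently of
   [w]. *)
pose M (i : X) := mass mu (pt i).
have M0 i : 0 <= M i by apply: sumr_ge0 => l _; have [+ _] := hmu l.
pose v := \sum_i point_cost pt cstar tau p M i.
have v0 : 0 <= v by apply: sumr_ge0 => i _; rewrite mulr_ge0// powR_ge0.
have vle : v <= coststar.
  by apply: (nearest_cost_le p mu nustar) hwstar near; lra.
pose Z t := total_error pt cstar tau (pi t) p eps alpha M.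
have mZ : measurable_fun setT Z by exact: (measurable_total_error P _ _ _ _ _ _ _ hdr).
pose K := v * (5 * alpha).
have K0 : 0 <= K by rewrite !mulr_ge0.
have heavy : (P [set t | (K / eta < Z t)%R] <= eta%:E)%E.
  apply: markov_gt => //.
    by move=> t; exact: (total_error_ge0 P _ _ _ _ _ _ _ hp heps hdr).
  exact: (integral_total_error_le P _ _ _ _ _ _ _ hp heps hdr).
(* Distortion is symmetric and absent on the diagonal, so pairs with increasing indices suffice. *)
pose Q := [pred x : 'I_n * 'I_n | (x.1 < x.2)%N].
pose D (x : 'I_n * 'I_n) := [set t | ~~ undistorted eps (pi t) (cstar x.1) (cstar x.2)].
have [mU PU] := @union_bound R dT T P _ Q D delta
  (fun x => measurable_distorted P _ _ _ _ _ _ _ hdr _ _)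
  (fun x _ => distorted_le P _ _ _ _ _ _ _ hdr _ _).
set U := [set t | _] in mU PU; rewrite card_ltn_pairs in PU.
set H := [set t | (K / eta < Z t)%R] in heavy.
have mH : measurable H by exact: measurable_gt.
exists (~` (H `|` U)); split.
- by apply: measurableC; exact: measurableU.
- rewrite probability_setC; last exact: measurableU.
  have PHU : (P (H `|` U) <= (eta + 'C(n, 2)%:R * delta)%R%:E)%E.
    by rewrite EFinD (le_trans (measureU2 _ _ _))// leeD.
  have Pf : P (H `|` U) \is a fin_num by apply: fin_num_measure; exact: measurableU.
  by move: PHU; rewrite -(fineK Pf) -EFinB !lee_fin; lra.
(* The weights enter only now, at a fixed outcome of the good event. *)
move=> t /not_orP[/negP nH nU] costC costpiC.
have hsol := hw.2 t.
have w0 x : 0 <= w t j x by exact: solution_ge0 hsol.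
have Zle : Z t <= K / eta by rewrite leNgt.
have cenU k1 k2 : undistorted eps (pi t) (cstar k1) (cstar k2).
  wlog lt : k1 k2 / (k1 < k2)%N.
    move=> wl; have [lt|lt|/val_inj ->] := ltngtP k1 k2; first exact: wl.
      by rewrite undistortedC; exact: wl.
    exact: undistorted_xx.
  by apply/negPn/negP => nd; apply: nU; exists (k1, k2).
have [H1 H2] := @wcost_distortion R X d m n pt cstar tau (pi t) p eps alpha M
  (fun i => w t j (pt i)) hp heps alpha0 halpha cenU (fun i => w0 _)
  (fun i => solution_le_mass _ _ _ _ _ hsol).
(* Combines [Z t <= 5 alpha v / eta] with [v <= coststar]. *)
have err : (1 + eps) `^ p * Z t * (eps `^ (p - 1))^-1 <= cea * coststar.
  have ee : 0 <= (eps `^ (p - 1))^-1 by rewrite invr_ge0 powR_ge0.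
  rewrite /cea (_ : _ * coststar = (1 + eps) `^ p * (coststar * (5 * alpha) / eta) *
      (eps `^ (p - 1))^-1).
    rewrite ler_wpM2r// ler_wpM2l ?powR_ge0// (le_trans Zle)// ler_pM2r ?invr_gt0//.
    by rewrite ler_wpM2r// mulr_ge0.
  by rewrite invfM; ring.
have A0 : 0 <= A by rewrite mulr_ge0 ?addr_ge0 ?mulr_ge0 ?powR_ge0.
rewrite /costC /costpiC !cluster_costE//; split.
  by rewrite (le_trans H1)// ler_wpM2l// lerD2l.
by rewrite (le_trans H2)// ler_wpM2l// lerD2l.
Qed.
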